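(* For every $i=1,\dots,l$ the following is a short exact sequence of maps among principal-like subspaces: $$0\longrightarrow W(\lambda_i)\xrightarrow{\ e_{\omega_i}\ }W(\lambda_0)\xrightarrow{\ \mathcal{Y}_c(e^{\lambda_i},x)\ }W(\lambda_i)\longrightarrow0.$$ In particular, for each fundamental weight $\Lambda_i$ of $\widehat{\mathfrak{g}}$ ($i=1,\dots,l$) such that $\langle\Lambda_i,\mathbf{k}\rangle=1$, the following is a short exact sequence among principal subspaces: $$0\longrightarrow W(\Lambda_i)\xrightarrow{\ e_{\omega_i}\ }W(\Lambda_0)\xrightarrow{\ \mathcal{Y}_c(e^{\lambda_i},x)\ }W(\Lambda_i)\longrightarrow0.$$
   Context: Let $\mathfrak{g}$ be a finite-dimensional complex simple Lie algebra of type $A$, $D$ or $E$ of rank $l$, with Cartan subalgebra $\mathfrak{h}$, simple roots $\alpha_1,\dots,\alpha_l$, set of roots $\Delta$, set of positive roots $\Delta_+$, and invariant form $\langle\cdot,\cdot\rangle$ normalized so that $\langle\alpha,\alpha\rangle=2$ for $\alpha\in\Delta$; identify $\mathfrak{h}$ with $\mathfrak{h}^*$ via this form. Let $\lambda_1,\dots,\lambda_l$ be the fundamental weights ($\langle\lambda_i,\alpha_j\rangle=\delta_{ij}$), $\lambda_0=0$, $Q=\sum_i\mathbb{Z}\alpha_i$ and $P=\sum_i\mathbb{Z}\lambda_i$ the root and weight lattices, and $\omega_i=\alpha_i-\lambda_i\in P$ for $i=1,\dots,l$. For each root $\alpha$ let $x_\alpha$ be a root vector (normalized below). Let $\widehat{\mathfrak{g}}=\mathfrak{g}\otimes\mathbb{C}[t,t^{-1}]\oplus\mathbb{C}\mathbf{k}$,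 $\mathbf{k}$ central, $[x\otimes t^m,y\otimes t^n]=[x,y]\otimes t^{m+n}+m\langle x,y\rangle\delta_{m+n,0}\mathbf{k}$. Let $\mathfrak{n}=\coprod_{\alpha\in\Delta_+}\mathbb{C}x_\alpha$ and $\bar{\mathfrak{n}}=\mathfrak{n}\otimes\mathbb{C}[t,t^{-1}]$. Let $\Lambda_0,\dots,\Lambda_l$ be the fundamental weights of $\widehat{\mathfrak{g}}$: $\langle\Lambda_0,\mathbf{k}\rangle=1$, and for $i\ge1$, $\langle\Lambda_i,\mathbf{k}\rangle$ is the coefficient of $\alpha_i$ in the highest root. The spaces $V_Q$, $V_P$. Fix $s>0$ and a 2-cocycle $\epsilon:P\times P\to\mathbb{C}^\times$ with values in the $s$-th roots of unity, normalized by $\epsilon(\alpha,0)=\epsilon(0,\alpha)=1$, whose commutator map $c(\alpha,\beta)=\epsilon(\alpha,\beta)/\epsilon(\beta,\alpha)$ (alternating and $\mathbb{Z}$-bilinear) satisfies $c(\alpha,\beta)=(-1)^{\langle\alpha,\beta\rangle}$ for $\alpha,\beta\in Q$; such data exist. Let $M(1)=S(\mathfrak{h}\otimes t^{-1}\mathbb{C}[t^{-1}])$ be the level one Fock module for $\widehat{\mathfrak{h}}=\mathfrak{h}\otimes\mathbb{C}[t,t^{-1}]\oplus\mathbb{C}\mathbf{k}$ on which $\mathfrak{h}\otimes\mathbb{C}[t]$ annihilates the vacuum, $V_P=M(1)\otimes\mathbb{C}[P]$ (where $\mathbb{C}[P]$ has basis $e^\beta$, $\beta\in P$) and $V_Q=M(1)\otimes\mathbb{C}[Q]$.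 For $h\in\mathfrak{h}$, $h(n)$ ($n\ne0$) acts on the factor $M(1)$ and $h(0)(v\otimes e^\beta)=\langle h,\beta\rangle v\otimes e^\beta$. For $\lambda\in P$ define $e_\lambda:V_P\to V_P$ by $e_\lambda(v\otimes e^\beta)=\epsilon(\lambda,\beta)v\otimes e^{\lambda+\beta}$, and put $x^\lambda(v\otimes e^\beta)=x^{\langle\lambda,\beta\rangle}v\otimes e^\beta$, $E^\pm(-\lambda,x)=\exp\left(\sum_{\pm n>0}\frac{-\lambda(n)}{n}x^{-n}\right)$, $Y(e^\lambda,x)=E^-(-\lambda,x)E^+(-\lambda,x)e_\lambda x^\lambda$. More generally, for $v=h_1(-n_1)\cdots h_k(-n_k)\otimes e^\beta\in V_Q$ (with $h_j\in\mathfrak{h}$, $n_j\ge1$, $\beta\in Q$), $Y(v,x)={:}\prod_{j=1}^k\left(\frac{1}{(n_j-1)!}\left(\frac{d}{dx}\right)^{n_j-1}h_j(x)\right)Y(e^\beta,x){:}$ where $h(x)=\sum_{n\in\mathbb{Z}}h(n)x^{-n-1}$ and ${:}\ {:}$ is the standard normal ordering. This makes $V_Q$ a vertex operator algebra (the lattice vertex operator algebra) with vacuum $1=1\otimes e^0$ and conformal vector $\omega=\frac12\sum_{j=1}^l u^{(j)}(-1)^2 1$ ($\{u^{(j)}\}$ an orthonormal basis of $\mathfrak{h}$), and $V_P$ a $V_Q$-module; $Y(\omega,x)=\sum_nL(n)x^{-n-2}$ defines the Virasoro operators $L(n)$. For $\alpha\in\Delta$ write $Y(e^\alpha,x)=\sum_{m\in\mathbb{Z}}x_\alpha(m)x^{-m-1}$.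 With suitably normalized root vectors $x_\alpha$, these operators with the $\widehat{\mathfrak{h}}$-action make $V_P$ a $\widehat{\mathfrak{g}}$-module of level one in which $x_\alpha\otimes t^m$ acts as $x_\alpha(m)$; this normalization is fixed. Write $e^\lambda$ for $1\otimes e^\lambda$. Principal(-like) subspaces. For $i=0,\dots,l$, $W(\lambda_i)=U(\bar{\mathfrak{n}})\cdot e^{\lambda_i}\subset V_P$. When $\langle\Lambda_i,\mathbf{k}\rangle=1$, the level one standard module $L(\Lambda_i)$ is identified with the irreducible submodule $M(1)\otimes\mathbb{C}[Q]e^{\lambda_i}$ of $V_P$ with highest weight vector $v_{\Lambda_i}=e^{\lambda_i}$, and its principal subspace $W(\Lambda_i)=U(\bar{\mathfrak{n}})\cdot v_{\Lambda_i}$ equals $W(\lambda_i)$. Maps. For $w\in V_P$, $v\in V_Q$ let $\mathcal{Y}(w,x)v=e^{xL(-1)}Y(v,-x)w$ (an intertwining operator), and let $\mathcal{Y}_c(e^{\lambda_i},x)$ denote the constant term (coefficient of $x^0$) of $\mathcal{Y}(e^{\lambda_i},x)$; it commutes with the action of $\bar{\mathfrak{n}}$, sends $e^0$ to $e^{\lambda_i}$, and hence restricts to a map $W(\lambda_0)\to W(\lambda_i)$. The map $e_{\omega_i}:W(\lambda_i)\to W(\lambda_0)$ is the restriction of the linear isomorphism $e_{\omega_i}$ of $V_P$ (it does map $W(\lambda_i)$ into $W(\lambda_0)$). *)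

(* Defs.v *)
From HB Require Import structures.
From mathcomp Require Import all_boot all_order all_algebra all_fingroup.
From mathcomp Require Import finmap.
From mathcomp.multinomials Require Import monalg.
From mathcomp Require Import boolp classical_sets functions cardinality fsbigop.

Set Implicit Arguments.
Unset Strict Implicit.
Unset Printing Implicit Defensive.

Import GRing.Theory.

Local Open Scope classical_set_scope.
Local Open Scope ring_scope.

Section LinearAlgebra.
Variable F : fieldType.

Definition subspace (M : lmodType F) (S : set M) : Prop :=
  S 0 /\ forall (c : F) (x y : M), S x -> S y -> S (c *: x + y).

Definition lspan (M : lmodType F) (S : set M) : set M :=
  [set x | forall U : set M, subspace U -> S `<=` U -> U x].

Definition linear_on (M N : lmodType F) (A : set M) (f : M -> N) : Prop :=
  forall (c : F) (x y : M), A x -> A y -> f (c *: x + y) = c *: f x + f y.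

(* 0 -> A -f-> B -g-> C -> 0, where A, B, C are subspaces and f, g are maps
   defined on (at least) A and B *)
Record short_exact (M1 M2 M3 : lmodType F) (A : set M1) (f : M1 -> M2)
    (B : set M2) (g : M2 -> M3) (C : set M3) : Prop := ShortExact {
  se_subspace1 : subspace A;
  se_subspace2 : subspace B;
  se_subspace3 : subspace C;
  se_linear1 : linear_on A f;
  se_linear2 : linear_on B g;
  se_maps1 : forall a, A a -> B (f a);
  se_maps2 : forall b, B b -> C (g b);
  se_inj : forall a a', A a -> A a' -> f a = f a' -> a = a';
  se_exact : forall b, B b -> (g b = 0 <-> exists2 a, A a & f a = b);
  se_surj : forall c, C c -> exists2 b, B b & g b = c }.

End LinearAlgebra.

(* Edges of the Dynkin diagrams on the vertices 0, ..., l-1 (to be symmetrized);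
   type E uses Bourbaki's numbering shifted by one *)
Definition edgeA (i j : nat) : bool := j == i.+1.
Definition edgeD (l i j : nat) : bool :=
  ((j == i.+1) && (j.+1 < l)%N) || ((j == i.+2) && (j.+1 == l)).
Definition edgeE (i j : nat) : bool :=
  [|| (i == 0%N) && (j == 2%N), (i == 1%N) && (j == 3%N)
    | (2 <= i)%N && (j == i.+1)].

Inductive ADE_diagram : nat -> (nat -> nat -> bool) -> Prop :=
| TypeA l of (1 <= l)%N : ADE_diagram l edgeA
| TypeD l of (4 <= l)%N : ADE_diagram l (edgeD l)
| TypeE l of (6 <= l <= 8)%N : ADE_diagram l edgeE.

Definition is_ADE_cartan (l : nat) (A : 'M[int]_l) : Prop :=
  exists (e : nat -> nat -> bool) (s : 'S_l), ADE_diagram l e /\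
    forall i j, A i j = if i == j then 2
                        else if e (s i) (s j) || e (s j) (s i) then -1 else 0.

Section LieAlgebra.
Variables (F : fieldType) (g : vectType F) (br : g -> g -> g).

Record is_lie_bracket : Prop := IsLieBracket {
  br_linl : forall y, linear (fun x => br x y);
  br_linr : forall x, linear (br x);
  br_alt : forall x, br x x = 0;
  br_jacobi : forall x y z,
    br x (br y z) + br y (br z x) + br z (br x y) = 0 }.

Definition is_simple_lie : Prop :=
  (exists x y, br x y <> 0) /\
  forall I : {vspace g}, (forall x y, y \in I -> br x y \in I) ->
    I = 0%VS \/ I = fullv.

Definition brv (U V : {vspace g}) : {vspace g} :=
  <<[seq br x y | x <- vbasis U, y <- vbasis V]>>%VS.

(* nilpotent and equal to its own normalizer *)
Definition is_cartan_subalgebra (h : {vspace g}) : Prop :=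
  (exists n : nat, iter n (brv h) h = 0%VS) /\
  forall x, x \in h <-> (forall y, y \in h -> br x y \in h).

(* A root is represented by an element a of h, through the form B *)
Definition root_vector (h : {vspace g}) (B : g -> g -> F) (a x : g) : Prop :=
  x <> 0 /\ forall y, y \in h -> br y x = B a y *: x.

Definition is_root (h : {vspace g}) (B : g -> g -> F) (a : g) : Prop :=
  [/\ a \in h, a <> 0 & exists x, root_vector h B a x].

End LieAlgebra.

(* A finite-dimensional simple Lie algebra of type A, D or E and rank l, with a
   Cartan subalgebra, the normalized invariant form, simple roots and
   fundamental weights; csa is identified with its dual through the form. *)
Record ade_algebra (F : fieldType) (l : nat) := ADEAlgebra {
  lie : vectType F;
  br : lie -> lie -> lie;
  brP : is_lie_bracket br;
  br_simple : is_simple_lie br;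
  csa : {vspace lie};
  csaP : is_cartan_subalgebra br csa;
  form : lie -> lie -> F;
  form_lin : forall x, linear (form x : lie -> F^o);
  form_sym : forall x y, form x y = form y x;
  form_inv : forall x y z, form (br x y) z = form x (br y z);
  form_root : forall a, is_root br csa form a -> form a a = 2;
  sroot : 'I_l -> lie;
  sroot_root : forall i, is_root br csa form (sroot i);
  sroot_basis : basis_of csa [seq sroot i | i : 'I_l];
  sroot_base : forall a, is_root br csa form a ->
    exists c : 'I_l -> nat, a = \sum_i sroot i *+ c i \/
                            a = - \sum_i sroot i *+ c i;
  cartan : 'M[int]_l;
  cartan_ADE : is_ADE_cartan cartan;
  cartanE : forall i j, form (sroot i) (sroot j) = (cartan i j)%:~R;
  fwt : 'I_l -> lie;
  fwt_csa : forall i, fwt i \in csa;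
  fwtE : forall i j, form (fwt i) (sroot j) = (i == j)%:R }.

Section Lattice.
Variables (F : fieldType) (l : nat) (D : ade_algebra F l).
Local Notation g := (lie D).

(* The weight lattice P in the coordinates given by the fundamental weights;
   wt is its embedding in the Cartan subalgebra. *)
Definition weight := 'rV[int]_l.
Definition wt (b : weight) : g := \sum_i fwt D i *~ b 0 i.
Definition lambda (i : 'I_l) : weight := delta_mx 0 i.
(* <alpha_i, alpha_j> is the coefficient of lambda_j in alpha_i *)
Definition alpha (i : 'I_l) : weight := row i (cartan D).
Definition omega (i : 'I_l) : weight := alpha i - lambda i.

Definition in_Q (b : weight) : Prop :=
  exists c : 'I_l -> int, b = \sum_i alpha i *~ c i.

Definition root (b : weight) : Prop := is_root (@br F l D) (csa D) (@form F l D) (wt b).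
Definition pos_root (b : weight) : Prop :=
  root b /\ exists c : 'I_l -> nat, b = \sum_i alpha i *+ c i.

(* c i is the coefficient of alpha_i in the highest root *)
Definition highest_root_coefs (c : 'I_l -> nat) : Prop :=
  root (\sum_i alpha i *+ c i) /\
  forall b, root b -> exists d : 'I_l -> nat,
    \sum_i alpha i *+ c i - b = \sum_i alpha i *+ d i.

(* The level <Lambda_i, k>; None stands for the index 0 *)
Definition level (i : option 'I_l) (n : nat) : Prop :=
  if i is Some j then exists2 c, highest_root_coefs c & c j = n else n = 1%N.

Record is_lattice_cocycle (s : nat) (eps : weight -> weight -> F) : Prop :=
  IsLatticeCocycle {
  eps_s_gt0 : (0 < s)%N;
  eps_root1 : forall a b, eps a b ^+ s = 1;
  eps_0r : forall a, eps a 0 = 1;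
  eps_0l : forall a, eps 0 a = 1;
  eps_cocycle : forall a b c,
    eps a b * eps (a + b) c = eps b c * eps a (b + c);
  eps_commutator : forall a b (n : int), in_Q a -> in_Q b ->
    form (wt a) (wt b) = n%:~R -> eps a b / eps b a = (-1) ^ n }.

End Lattice.

Section LatticeVOA.
Variables (F : fieldType) (l : nat) (D : ade_algebra F l).
Variable eps : weight l -> weight l -> F.
Local Notation g := (lie D).
Local Notation P := (weight l).

(* A basis of M(1): the monomials in alpha_j(-n-1), which is the variable (j, n) *)
Definition fock_monom := {cmonom ('I_l * nat)%type}.
(* V_P = M(1) (x) C[P], by its basis m (x) e^b *)
Definition VP := {malg F[(fock_monom * P)%type]}.
HB.instance Definition _ := GRing.Lmodule.on VP.

Definition bas (b : fock_monom * P) : VP := << b >>.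
Definition expv (b : P) : VP := bas (mone, b).
Definition vac : VP := expv 0.

Definition lin_ext (M : lmodType F) (f : fock_monom * P -> M) (v : VP) : M :=
  \sum_(b <- msupp v) v@_b *: f b.

(* h(n) for h in the Cartan subalgebra. <h, lambda_j> is the coefficient of
   alpha_j in h, and h(n), n > 0, is the derivation of M(1) which sends
   alpha_j(-n) to n <h, alpha_j>. *)
Definition heis (h : g) (n : int) : VP -> VP :=
  match n with
  | Posz 0 => lin_ext (fun b => form h (wt D b.2) *: bas b)
  | Posz m.+1 => lin_ext (fun b => \sum_(j < l)
      (m.+1%:R * form h (sroot D j) * (b.1 (j, m))%:R) *:
        bas (divcm b.1 (ucm (j, m)), b.2))
  | Negz m => lin_ext (fun b => \sum_(j < l)
      form h (fwt D j) *: bas (mmul (ucm (j, m)) b.1, b.2))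
  end.

Definition e_op (a : P) : VP -> VP :=
  lin_ext (fun b => eps a b.2 *: bas (b.1, a + b.2)).

(* Formal series in x with operator coefficients: A k is the coefficient of x^k.
   A sum over \in A is the sum of the finitely many nonzero terms; for the
   series used here only finitely many terms are nonzero on each vector. *)
Definition opser := int -> VP -> VP.

Definition sone : opser := fun k v => if k == 0 then v else 0.
Definition smul (A B : opser) : opser :=
  fun k v => \sum_(p \in [set: int]) A p (B (k - p) v).
Definition sexp (A : opser) : opser :=
  fun k v => \sum_(n \in [set: nat]) (n`!%:R)^-1 *: iter n (smul A) sone k v.
Definition sder (A : opser) : opser :=
  fun k v => (k + 1)%:~R *: A (k + 1) v.
Definition sdivder (n : nat) (A : opser) : opser :=
  fun k v => (n`!%:R)^-1 *: iter n sder A k v.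

(* x^a; only used for a in Q, when all the exponents are integers *)
Definition xpow (a : P) : opser := fun k =>
  lin_ext (fun b => if form (wt D a) (wt D b.2) == k%:~R then bas b else 0).

(* E^-(-a, x) and E^+(-a, x): the coefficient of x^k involves a(n) for n = -k *)
Definition Eminus (a : P) : opser :=
  sexp (fun k v => let n := - k in
    if n < 0 then - (n%:~R)^-1 *: heis (wt D a) n v else 0).
Definition Eplus (a : P) : opser :=
  sexp (fun k v => let n := - k in
    if 0 < n then - (n%:~R)^-1 *: heis (wt D a) n v else 0).

(* Y(e^a, x) for a in Q *)
Definition Yexp (a : P) : opser :=
  smul (Eminus a) (smul (Eplus a) (fun k v => e_op a (xpow a k v))).

Definition xmode (a : P) (m : int) : VP -> VP := Yexp a (- m - 1).

(* The parts of h(x) = \sum_n h(n) x^(-n-1) with n < 0 and with 0 <= n *)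
Definition current_neg (h : g) : opser := fun k v =>
  let n := - k - 1 in if n < 0 then heis h n v else 0.
Definition current_pos (h : g) : opser := fun k v =>
  let n := - k - 1 in if 0 <= n then heis h n v else 0.

(* The normally ordered product :(1/n! (d/dx)^n h(x)) B(x): *)
Definition nord (h : g) (n : nat) (B : opser) : opser := fun k v =>
  smul (sdivder n (current_neg h)) B k v +
  smul B (sdivder n (current_pos h)) k v.

(* The variables of a monomial, listed with their multiplicities *)
Definition fock_seq (m : fock_monom) : seq ('I_l * nat) :=
  flatten [seq nseq (m q) q | q <- finsupp m].

(* Y(v, x) for v in V_Q, by linearity in v; in the normally ordered product the
   variable (j, n) stands for alpha_j(-n-1) *)
Definition Ybas (b : fock_monom * P) : opser :=
  foldr (fun q B => nord (sroot D q.1) q.2 B) (Yexp b.2) (fock_seq b.1).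
Definition Yop (v : VP) : opser :=
  fun k w => lin_ext (fun b => Ybas b k w) v.

Definition orthonormal_basis (u : 'I_l -> g) : Prop :=
  basis_of (csa D) [seq u j | j : 'I_l] /\
  forall i j, form (u i) (u j) = (i == j)%:R.

Definition conformal_vector (u : 'I_l -> g) : VP :=
  2^-1 *: \sum_j heis (u j) (-1) (heis (u j) (-1) vac).
Definition virasoro (u : 'I_l -> g) (n : int) : VP -> VP :=
  Yop (conformal_vector u) (- n - 2).

(* The coefficient of x^k in e^(x L(-1)) Y(v, -x) w, for v in V_Q *)
Definition intertwining (u : 'I_l -> g) (w v : VP) (k : int) : VP :=
  smul (sexp (fun k v => if k == 1 then virasoro u (-1) v else 0))
       (fun k w => (-1) ^ k *: Yop v k w) k w.

Definition Yc (u : 'I_l -> g) (a : P) (v : VP) : VP :=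
  intertwining u (expv a) v 0.

(* Normalized root vectors: V_P is a level one module of the affine Lie algebra,
   gact x n being the action of x (x) t^n *)
Record affine_action := AffineAction {
  xroot : P -> g;
  gact : g -> int -> VP -> VP;
  xrootP : forall a, root D a ->
    root_vector (@br F l D) (csa D) (@form F l D) (wt D a) (xroot a);
  gact_linl : forall n v, linear (fun x => gact x n v);
  gact_linr : forall x n, linear (gact x n);
  gact_br : forall x y m n v,
    gact x m (gact y n v) - gact y n (gact x m v) =
    gact (br x y) (m + n) v +
    (if m + n == 0 then (m%:~R * form x y) *: v else 0);
  gact_csa : forall h n v, h \in csa D -> gact h n v = heis h n v;
  gact_root : forall a n v, root D a -> gact (xroot a) n v = xmode a n v }.

Variable X : affine_action.

Definition nplus : set g := lspan [set xroot X a | a in pos_root D].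

(* U(nbar) v, as the smallest nbar-submodule containing v; nbar is spanned by
   the x (x) t^n with x in nplus *)
Definition Unbar (v : VP) : set VP :=
  [set w | forall U : set VP, subspace U -> U v ->
     (forall x n w', nplus x -> U w' -> U (gact X x n w')) -> U w].

(* W(lambda_i) for a = lambda_i, and W(lambda_0) for a = 0 *)
Definition W (a : P) : set VP := Unbar (expv a).

(* Principal subspaces: when Lambda_i has level one, L(Lambda_i) is the
   submodule M(1) (x) C[Q]e^(lambda_i) of V_P, with highest weight vector
   e^(lambda_i). The index 0 is None. *)
Definition v_Lambda (i : option 'I_l) : VP :=
  expv (if i is Some j then lambda j else 0).
Definition W_Lambda (i : option 'I_l) : set VP := Unbar (v_Lambda i).

End LatticeVOA.

(* Main.v *)
(* Identify M(1) with the polynomial ring in the variables x_(j,n) = alpha_j(-n-1), and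
   read these as the power sums of one alphabet for each colour j. The coefficients of
   H_j(z) = exp (sum_(n > 0) alpha_j(-n) z^n / n) are then the complete symmetric functions
   h_(j,k), and h_(j,0) = 1. Since E^-(-alpha, z) is a product of series H_j(z), and E^+
   preserves the list of colours of a product of h's and only lowers its weight, W(la) has
   the spanning set of vectors
      h_(j_1,k_1) ... h_(j_r,k_r) (x) e^(la + alpha_(j_1) + ... + alpha_(j_r)),
   where factors h_(j,0) = 1 are allowed. On such a vector of W(0), Y(v, x) e^(lambda_i) has
   no negative power of x, so that L(-1) does not contribute to the constant term, which
   is, up to a nonzero scalar, the vector of W(lambda_i) where each h_(i,k) has become
   h_(i,k-1) (and h_(i,-1) = 0), while e_(omega_i) amounts to inserting a factor h_(i,0).
   As the h_(j,k) with k > 0 are algebraically independent, the kernel of the former map is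
   the image of the latter. *)
From HB Require Import structures.
From mathcomp Require Import all_boot all_order all_algebra reals complex.
From mathcomp Require Import finmap zify.
From mathcomp.multinomials Require Import monalg.
From mathcomp Require Import boolp classical_sets functions cardinality fsbigop.
Require Import Defs.

Set Implicit Arguments.
Unset Strict Implicit.
Unset Printing Implicit Defensive.

Import Order.TTheory GRing.Theory Num.Theory.

Local Open Scope classical_set_scope.
Local Open Scope ring_scope.

(** * Subspaces and linear extension *)

Section Subspaces.
Variable F : fieldType.
Implicit Types M N : lmodType F.

Lemma subspace_0 M (S : set M) : subspace S -> S 0.
Proof. by case. Qed.

Lemma subspaceP M (S : set M) : subspace S ->
  forall c x y, S x -> S y -> S (c *: x + y).
Proof. by case. Qed.

Lemma subspaceD M (S : set M) : subspace S -> forall x y, S x -> S y -> S (x + y).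
Proof. by move=> [_ S1] x y Sx Sy; have := S1 1 x y Sx Sy; rewrite scale1r. Qed.

Lemma subspaceZ M (S : set M) : subspace S -> forall c x, S x -> S (c *: x).
Proof. by move=> [S0 S1] c x Sx; have := S1 c x 0 Sx S0; rewrite addr0. Qed.

Lemma subspaceB M (S : set M) : subspace S -> forall x y, S x -> S y -> S (x - y).
Proof.
move=> SS x y Sx Sy; apply: subspaceD => //.
by rewrite -scaleN1r; apply: subspaceZ.
Qed.

Lemma subspace_sum M (S : set M) (I : eqType) (r : seq I) (f : I -> M) :
  subspace S -> (forall i, i \in r -> S (f i)) -> S (\sum_(i <- r) f i).
Proof.
move=> SS Sf; rewrite big_seq; elim/big_rec: _ => [|i x ir]; first by have := subspace_0 SS.
by apply: subspaceD => //; apply: Sf.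
Qed.

Lemma subspace_fsum M (S : set M) (I : choiceType) (A : set I) (f : I -> M) :
  subspace S -> (forall i, A i -> S (f i)) -> S (\sum_(i \in A) f i).
Proof.
move=> SS Sf; case: (pselect (finite_set (A `&` f @^-1` [set~ 0]))) => fA; last first.
  by rewrite fsbig_dflt //; apply: subspace_0 SS.
apply: subspace_sum => // i; rewrite in_finite_support // inE => -[Ai _].
exact: Sf.
Qed.

Lemma subspace_lspan M (S : set M) : subspace (lspan S).
Proof.
split=> [U [U0 _] _ //|c x y Sx Sy U US SU].
by apply: subspaceP => //; [apply: Sx|apply: Sy].
Qed.

Lemma lspan_gen M (S : set M) x : S x -> lspan S x.
Proof. by move=> Sx U _; apply. Qed.

Lemma lspan_min M (S U : set M) :
  subspace U -> (forall x, S x -> U x) -> forall x, lspan S x -> U x.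
Proof. by move=> US SU x; apply. Qed.

Lemma lin0 M N (f : M -> N) : linear f -> f 0 = 0.
Proof. by move=> lf; have := lf (-1) 0 0; rewrite !addr0 !scaler0 !scaleN1r !addNr. Qed.

Lemma linZ M N (f : M -> N) : linear f -> forall c x, f (c *: x) = c *: f x.
Proof. by move=> lf c x; have := lf c x 0; rewrite !addr0 (lin0 lf) addr0. Qed.

Lemma linD M N (f : M -> N) : linear f -> forall x y, f (x + y) = f x + f y.
Proof. by move=> lf x y; have := lf 1 x y; rewrite !scale1r. Qed.

Lemma subspace_preim M N (f : M -> N) (S : set N) :
  linear f -> subspace S -> subspace [set x | S (f x)].
Proof.
move=> lf SS; split=> [|c x y Sx Sy] /=.
  by rewrite (lin0 lf); exact: subspace_0 SS.
by rewrite lf; apply: subspaceP.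
Qed.

Lemma subspace_eq M N (f g : M -> N) :
  linear f -> linear g -> subspace [set x | f x = g x].
Proof.
move=> lf lg; split=> [|c x y /= fx fy] /=; last by rewrite lf lg fx fy.
by rewrite !lin0.
Qed.

Lemma subspace0 M : subspace [set 0 : M].
Proof. by split=> [//|c x y /= -> ->]; rewrite scaler0 addr0. Qed.

Lemma lin_sum M N (f : M -> N) : linear f ->
  forall (I : Type) (r : seq I) (P : pred I) (E : I -> M),
  f (\sum_(i <- r | P i) E i) = \sum_(i <- r | P i) f (E i).
Proof.
move=> lf I r P E; elim/big_rec2: _ => [|i y1 y2 _ <-]; first exact: lin0.
exact: linD.
Qed.

Lemma lin_mul (B : comAlgType F) (a : B) : linear (fun b => a * b).
Proof. by move=> c x y; rewrite mulrDr scalerAr. Qed.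

Lemma lin_comp (M N P : lmodType F) (f : M -> N) (g : N -> P) :
  linear f -> linear g -> linear (fun x => g (f x)).
Proof. by move=> lf lg c x y; rewrite lf lg. Qed.

Lemma lin_add (M N : lmodType F) (f g : M -> N) :
  linear f -> linear g -> linear (fun x => f x + g x).
Proof. by move=> lf lg c x y; rewrite lf lg scalerDr addrACA. Qed.

Lemma fsum_seq M (I : choiceType) (r : seq I) (f : I -> M) :
  uniq r -> (forall i, f i <> 0 -> i \in r) ->
  \sum_(i \in [set: I]) f i = \sum_(i <- r) f i.
Proof.
move=> ur fr; rewrite (fsbigE r) //.
- by apply: eq_bigl => i; rewrite mem_set.
- move=> i _; apply: contraNeq => /eqP; exact: fr.
Qed.

Lemma fsum_nat_int M (f : int -> M) n :
  (forall p, f p <> 0 -> exists2 k : nat, (k < n)%N & p = Posz k) ->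
  \sum_(p \in [set: int]) f p = \sum_(k < n) f (Posz k).
Proof.
move=> fn; rewrite (@fsum_seq _ _ (map Posz (iota 0 n))).
- by rewrite big_map -{1}[n]subn0 big_mkord.
- by rewrite map_inj_uniq ?iota_uniq // => x y [].
- move=> p /fn [k kn ->]; rewrite mem_map; last by move=> x y [].
  by rewrite mem_iota.
Qed.

Lemma fsum_one M (I : choiceType) (f : I -> M) (i0 : I) :
  (forall i, i <> i0 -> f i = 0) -> \sum_(i \in [set: I]) f i = f i0.
Proof.
move=> fi; rewrite (@fsum_seq _ _ [:: i0]) ?big_seq1 // => i fi0.
by rewrite inE; apply: contra_notT fi0 => /eqP; apply: fi.
Qed.

End Subspaces.

Fact lext_key : unit. Proof. exact: tt. Qed.

Section LinearExtension.
Variables (F : fieldType) (K : choiceType).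

(* locked: unifying two explicit extensions is very expensive *)
Definition lext (M : lmodType F) (f : K -> M) : {malg F[K]} -> M :=
  locked_with lext_key (fun v => \sum_(k <- msupp v) v@_k *: f k).

Lemma lextE (M : lmodType F) (f : K -> M) (v : {malg F[K]}) :
  lext f v = \sum_(k <- msupp v) v@_k *: f k.
Proof. by rewrite /lext unlock. Qed.

Lemma lextw (M : lmodType F) (f : K -> M) (v : {malg F[K]}) (d : {fset K}) :
  (msupp v `<=` d)%fset -> lext f v = \sum_(k <- d) v@_k *: f k.
Proof.
move=> vd; rewrite lextE (big_fset_incl _ vd) // => k _ /mcoeff_outdom ->.
by rewrite scale0r.
Qed.

Lemma lext_linear (M : lmodType F) (f : K -> M) : linear (lext f).
Proof.
move=> c v w; set d := (msupp v `|` msupp w)%fset.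
have dv : (msupp v `<=` d)%fset by apply: fsubsetUl.
have dw : (msupp w `<=` d)%fset by apply: fsubsetUr.
rewrite (lextw f dv) (lextw f dw) (@lextw _ _ _ d); last first.
  apply: fsubset_trans (msuppD_le _ _) _; apply: fsetSU.
  exact: msuppZ_le.
rewrite scaler_sumr -big_split /=; apply: eq_bigr => k _.
by rewrite mcoeffD mcoeffZ scalerDl scalerA.
Qed.

Lemma lextU (M : lmodType F) (f : K -> M) k : lext f << k >> = f k.
Proof.
by rewrite lextE msuppU oner_eq0 big_seq_fset1 mcoeffUU scale1r.
Qed.

Lemma malg_subspace (S : set {malg F[K]}) :
  subspace S -> (forall k, S << k >>) -> forall v, S v.
Proof.
move=> SS SU v; rewrite (monalgE v); apply: subspace_sum => // k _.
suff -> : << v@_k *g k >> = v@_k *: << k >> by apply: subspaceZ.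
by apply/malgP => k'; rewrite mcoeffZ !mcoeffU mulrnAr mulr1.
Qed.

Lemma malg_linear_ext (M : lmodType F) (f g : {malg F[K]} -> M) :
  linear f -> linear g -> (forall k, f << k >> = g << k >>) -> f =1 g.
Proof. by move=> lf lg fg; apply: malg_subspace => //; apply: subspace_eq. Qed.

End LinearExtension.

(** * Formal power series *)

Definition pser (A : Type) := nat -> A.

Section PowerSeriesRing.
Variable A : comNzRingType.

HB.instance Definition _ := GRing.Zmodule.copy (pser A) (nat -> A).

Implicit Types p q r : pser A.

Definition pone : pser A := fun n => (n == 0%N)%:R.
Definition pmul p q : pser A := fun n => \sum_(i < n.+1) p i * q (n - i)%N.

Definition ptrunc n p : {poly A} := \poly_(i < n) p i.

Lemma pmul_trunc n p q i :
  (i < n)%N -> pmul p q i = (ptrunc n p * ptrunc n q)`_i.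
Proof.
move=> ltin; rewrite coefM; apply: eq_bigr => j _; rewrite !coef_poly.
have ji := leq_ord j.
by rewrite (leq_ltn_trans ji ltin) (leq_ltn_trans (leq_subr _ _) ltin).
Qed.

Lemma coef_mul_congr (n : nat) (P P' Q : {poly A}) :
  (forall i, (i < n)%N -> P`_i = P'`_i) ->
  forall i, (i < n)%N -> (P * Q)`_i = (P' * Q)`_i.
Proof.
move=> PP i ltin; rewrite !coefM; apply: eq_bigr => j _.
by rewrite PP // (leq_ltn_trans (leq_ord j) ltin).
Qed.

Lemma pmulC : commutative pmul.
Proof.
by move=> p q; apply/funext => n; rewrite !(@pmul_trunc n.+1) // mulrC.
Qed.

Lemma pmulA : associative pmul.
Proof.
have E p q r n : pmul (pmul p q) r n =
    (ptrunc n.+1 p * ptrunc n.+1 q * ptrunc n.+1 r)`_n.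
  rewrite (@pmul_trunc n.+1) //; apply: coef_mul_congr (ltnSn n) => i lti.
  by rewrite -(pmul_trunc _ _ lti) coef_poly lti.
move=> p q r; apply/funext => n.
by rewrite pmulC !E mulrC mulrA.
Qed.

Lemma pmul1 : left_id pone pmul.
Proof.
move=> p; apply/funext => n; rewrite /pmul big_ord_recl /pone mul1r subn0.
by rewrite big1 ?addr0 // => i _; rewrite mul0r.
Qed.

Lemma pmulDl : left_distributive pmul +%R.
Proof.
move=> p q r; apply/funext => n; rewrite -[RHS]/(pmul p r n + pmul q r n).
by rewrite /pmul -big_split; apply: eq_bigr => i _; apply: mulrDl.
Qed.

Lemma pone_neq0 : pone != 0.
Proof.
by apply/eqP => /(congr1 (fun p : pser A => p 0%N)) /eqP; rewrite oner_eq0.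
Qed.

HB.instance Definition _ := GRing.Zmodule_isComNzRing.Build (pser A)
  pmulA pmulC pmul1 pmulDl pone_neq0.

Lemma pserM p q n : (p * q) n = \sum_(i < n.+1) p i * q (n - i)%N.
Proof. by []. Qed.

Lemma pser1 n : (1 : pser A) n = (n == 0%N)%:R.
Proof. by []. Qed.

Lemma pserD p q n : (p + q) n = p n + q n.
Proof. by []. Qed.

Lemma pserMn p n k : (p *+ n) k = p k *+ n.
Proof. by elim: n => [|n IH] //; rewrite !mulrSr -IH. Qed.

Lemma pser_sum (I : Type) (r : seq I) (P : pred I) (f : I -> pser A) n :
  (\sum_(i <- r | P i) f i) n = \sum_(i <- r | P i) f i n.
Proof. by elim/big_rec2: _ => // i y x _ <-. Qed.

Definition pcoef p (k : int) : A := if k is Posz n then p n else 0.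

(* [s] may be negative, and then [c] is 0 *)
Definition low_term p (s : int) (c : A) : Prop :=
  (forall k, k < s -> pcoef p k = 0) /\ pcoef p s = c.

Lemma low_termM p q s t c d :
  low_term p s c -> low_term q t d -> low_term (p * q) (s + t) (c * d).
Proof.
move=> [ps <-] [qt <-].
have Z (i n : nat) : (i <= n)%N -> Posz n <= s + t -> Posz i <> s -> p i * q (n - i)%N = 0.
  move=> lein nst ins; have [li|li] := ltP (Posz i) s.
    by have /= -> := ps _ li; rewrite mul0r.
  have /= -> := qt (Posz (n - i)) _; first by rewrite mulr0.
  by lia.
split=> [[n|n] // nst|].
  rewrite /= pserM big1 // => i _; have [E|E] := eqVneq (Posz i) s.
    have /= -> := qt (Posz (n - i)) _; first by rewrite mulr0.
    by have := ltn_ord i; lia.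
  by apply: Z; [exact: leq_ord|lia|exact/eqP].
case E: (s + t) => [n|n] /=; last first.
  case: s E {ps qt Z} => [s|s] E; last by rewrite mul0r.
  case: t E => [t|t] E; last by rewrite mulr0.
  by exfalso; lia.
rewrite pserM; case: s E Z {ps qt} => [i|s] E Z.
  case: t E Z => [j|t] E Z /=.
    have ni : (i < n.+1)%N by lia.
    rewrite (bigD1 (Ordinal ni)) //= big1 ?addr0 => [|k ki].
      by congr (_ * q _); lia.
    apply: Z; [exact: leq_ord|lia|move=> [] ki'; case/eqP: ki; exact: val_inj].
  rewrite mulr0 big1 // => k _; apply: Z; [exact: leq_ord|lia|].
  by have := ltn_ord k; lia.
rewrite mul0r big1 // => k _; apply: Z; [exact: leq_ord|lia|by []].
Qed.

Definition peuler p : pser A := fun n => p n *+ n.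

Lemma peulerM p q : peuler (p * q) = peuler p * q + p * peuler q.
Proof.
apply/funext => n; rewrite /peuler pserD !pserM -sumrMnl -big_split /=.
apply: eq_bigr => i _; rewrite mulrnAl mulrnAr -mulrnDr subnKC //.
exact: leq_ord.
Qed.

Lemma peuler1 : peuler 1 = 0.
Proof. by apply/funext => -[|n]; rewrite /peuler pser1 // mul0rn. Qed.

Lemma peulerX p n : peuler (p ^+ n.+1) = (p ^+ n * peuler p) *+ n.+1.
Proof.
elim: n => [|n IH]; first by rewrite expr0 expr1 mul1r.
rewrite exprS peulerM IH mulrnAr mulrA -exprS mulrC -mulrS.
by [].
Qed.

Lemma pser_pow_low p n k : p 0%N = 0 -> (k < n)%N -> (p ^+ n) k = 0.
Proof.
move=> p0; elim: n k => // n IH k ltk; rewrite exprS pserM big1 // => -[[|i] lti] _ /=.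
  by rewrite p0 mul0r.
by rewrite IH ?mulr0 //; lia.
Qed.

End PowerSeriesRing.

HB.instance Definition _ (F : nzRingType) (A : lmodType F) :=
  GRing.Lmodule.copy (pser A) (nat -> A).

Section PowerSeriesAlgebra.
Variables (F : fieldType) (A : comAlgType F).

Fact pser_scalerAl (c : F) (p q : pser A) : c *: (p * q) = c *: p * q.
Proof.
apply/funext => n; rewrite -[LHS]/(c *: (p * q) n) !pserM scaler_sumr.
by apply: eq_bigr => i _; apply: scalerAl.
Qed.

HB.instance Definition _ :=
  GRing.Lmodule_isLalgebra.Build F (pser A) pser_scalerAl.
HB.instance Definition _ := GRing.Lalgebra_isComAlgebra.Build F (pser A).

End PowerSeriesAlgebra.

Section PowerSeriesExp.
Variables (F : fieldType) (A : comAlgType F).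
Hypothesis char0 : [pchar F] =i pred0.
Implicit Types p q r : pser A.

Lemma natr_neq0 n : (n.+1%:R : F) != 0.
Proof. by move/pcharf0P: char0 => ->. Qed.

Lemma pserZ (c : F) p n : (c *: p) n = c *: p n.
Proof. by []. Qed.

Definition pexp p : pser A := fun n => \sum_(k < n.+1) (k`!%:R)^-1 *: (p ^+ k) n.

Record is_exp p q : Prop := IsExp {
  is_exp_low : p 0%N = 0;
  is_exp_const : q 0%N = 1;
  is_exp_ode : peuler q = peuler p * q }.

Lemma is_exp0 : is_exp 0 1.
Proof. by split=> //; rewrite peuler1 /peuler mulr1; apply/funext => n; rewrite mul0rn. Qed.

Lemma is_expD p q p' q' : is_exp p q -> is_exp p' q' -> is_exp (p + p') (q * q').
Proof.
move=> [p0 q0 E] [p0' q0' E']; split.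
- by rewrite pserD p0 p0' addr0.
- by rewrite pserM big_ord1 q0 q0' mulr1.
have -> : peuler (p + p') = peuler p + peuler p'.
  by apply/funext => n; rewrite /peuler pserD mulrnDl.
by rewrite peulerM E E' mulrDl !mulrA (mulrC q (peuler p')).
Qed.

Lemma is_exp_sum (I : Type) (r : seq I) (p q : I -> pser A) :
  (forall i, is_exp (p i) (q i)) -> is_exp (\sum_(i <- r) p i) (\prod_(i <- r) q i).
Proof.
by move=> pq; elim/big_rec2: _ => [|i y1 y2 _ IH]; [apply: is_exp0|apply: is_expD].
Qed.

Lemma pexp_widen p n m : p 0%N = 0 -> (n < m)%N ->
  pexp p n = \sum_(k < m) (k`!%:R)^-1 *: (p ^+ k) n.
Proof.
move=> p0 ltnm.
rewrite /pexp (big_ord_widen m (fun k => (k`!%:R : F)^-1 *: (p ^+ k : pser A) n) ltnm).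
rewrite big_mkcond; apply: eq_bigr => k _; case: ltnP => // ltk.
by rewrite pser_pow_low ?scaler0.
Qed.

Lemma pexpP p : p 0%N = 0 -> is_exp p (pexp p).
Proof.
move=> p0; split=> //.
  by rewrite /pexp big_ord1 expr0 fact0 invr1 scale1r.
apply/funext => n; rewrite /peuler (@pexp_widen p n n.+2) // pserM.
under [RHS]eq_bigr => i _ do
  rewrite (@pexp_widen p (n - i) n.+1) ?ltnS ?leq_subr // mulr_sumr.
rewrite exchange_big /= -sumrMnl big_ord_recl /= expr0 pser1.
have -> : (1 %:R^-1 *: (n == 0%N)%:R) *+ n = 0 :> A.
  by case: n => [|n] //; rewrite scaler0 mul0rn.
rewrite add0r; apply: eq_bigr => k _; rewrite /bump /= add1n.
rewrite scalerMnr -/(peuler (p ^+ k.+1) n) peulerX mulrC pserMn -scaler_nat scalerA.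
rewrite factS natrM invfM -mulrA mulrCA mulVf ?natr_neq0 // mulr1 pserM scaler_sumr.
by apply: eq_bigr => i _; rewrite /peuler scalerAr.
Qed.

Lemma is_exp_uniq p q q' : is_exp p q -> is_exp p q' -> q = q'.
Proof.
move=> [p0 q0 E] [_ q0' E']; apply/funext => n.
elim/ltn_ind: n => -[|n] IH; first by rewrite q0.
have X r : peuler r = peuler p * r ->
    r n.+1 = (n.+1%:R^-1 : F) *: \sum_(i < n.+1) (peuler p) i.+1 * r (n - i)%N.
  move=> /(congr1 (fun s : pser A => s n.+1)); rewrite pserM big_ord_recl.
  rewrite {2}/peuler mulr0n mul0r add0r => er.
  apply: (scalerI (natr_neq0 n)); rewrite scalerA divff ?natr_neq0 // scale1r.
  by rewrite scaler_nat -er.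
rewrite (X _ E) (X _ E'); congr (_ *: _); apply: eq_bigr => i _.
by rewrite IH //; lia.
Qed.

End PowerSeriesExp.

(** * Complete symmetric functions *)

Section CompleteSymmetric.
Variables (F : fieldType) (I0 : eqType).
Hypothesis char0 : [pchar F] =i pred0.
Local Notation I := (I0 * nat)%type.
Variables (B : comAlgType F) (x : I -> B).
Implicit Types (f g : B) (q : I) (k : seq I).

(* log of [hseries j]; the variable (j, n) stands for the power sum p_(n+1) *)
Definition plog (j : I0) : pser B :=
  fun n => if n is m.+1 then (m.+1%:R : F)^-1 *: x (j, m) else 0.

Definition hseries (j : I0) : pser B := pexp (plog j).

Definition hsym q : B := hseries q.1 q.2.

Definition hprod k : B := \prod_(q <- k) hsym q.

Lemma hseriesP j : is_exp (plog j) (hseries j).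
Proof. exact: pexpP. Qed.

Lemma hsym0 j : hsym (j, 0%N) = 1.
Proof. by case: (hseriesP j). Qed.

Lemma peuler_plog j n : peuler (plog j) n.+1 = x (j, n).
Proof.
by rewrite /peuler /plog -scaler_nat scalerA divff ?scale1r // natr_neq0.
Qed.

Lemma hsym_newton j n : n.+1%:R *: hsym (j, n.+1) =
  \sum_(r < n.+1) x (j, r : nat) * hsym (j, (n - r)%N).
Proof.
have [_ _ /(congr1 (fun s : pser B => s n.+1))] := hseriesP j.
rewrite scaler_nat pserM big_ord_recl mul0r add0r => E.
rewrite -[LHS]/(peuler (hseries j) n.+1) E.
by apply: eq_bigr => r _; rewrite peuler_plog.
Qed.

Lemma hsym_newton_mul j n f : n.+1%:R *: (hsym (j, n.+1) * f) =
  \sum_(r < n.+1) x (j, r : nat) * (hsym (j, (n - r)%N) * f).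
Proof.
by rewrite scalerAl hsym_newton mulr_suml; apply: eq_bigr => r _; rewrite mulrA.
Qed.

Lemma hsym_ind (S : nat -> B -> Prop) :
  (forall f, S 0%N f) ->
  (forall n f, (forall r, (r < n.+1)%N -> forall g, S r g) -> S n.+1 f) ->
  forall n f, S n f.
Proof.
move=> S0 SS; elim/ltn_ind => -[|n] IH f //; exact: SS.
Qed.

Lemma hsym_deriv (d : B -> B) (c : I0 -> F) n : linear d ->
  (forall q f, d (x q * f) =
     (if q.2 == n then n.+1%:R * c q.1 else 0) *: f + x q * d f) ->
  forall j r f, d (hsym (j, r) * f) =
  c j *: ((if (n < r)%N then hsym (j, (r - n.+1)%N) else 0) * f)
    + hsym (j, r) * d f.
Proof.
move=> dlin dx j;  apply: hsym_ind => [f|r f IH].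
  by rewrite hsym0 !mul1r mul0r scaler0 add0r.
apply: (scalerI (natr_neq0 char0 r)).
rewrite -(linZ dlin) hsym_newton_mul (lin_sum dlin).
transitivity (\sum_(i < r.+1)
   (((if (i : nat) == n then n.+1%:R * c j else 0) *: (hsym (j, (r - i)%N) * f)
    + c j *: (x (j, i : nat) *
       (if (n < r - i)%N then hsym (j, (r - i - n.+1)%N) else 0) * f))
    + x (j, i : nat) * (hsym (j, (r - i)%N) * d f))).
  apply: eq_bigr => i _; rewrite dx IH ?ltnS ?leq_subr //.
  by rewrite mulrDr addrA -scalerAr -mulrA.
rewrite big_split /= -hsym_newton_mul scalerDr; congr (_ + _).
rewrite big_split /= -scaler_sumr -mulr_suml.
have -> : \sum_(i < r.+1) x (j, i : nat) *
      (if (n < r - i)%N then hsym (j, (r - i - n.+1)%N) else 0) =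
    if (n < r)%N then (r - n)%:R *: hsym (j, (r - n)%N) else 0.
  case: ltnP => nr; last first.
    by rewrite big1 // => i _; rewrite ifF ?mulr0 //; lia.
  have [e rE] : exists e, r = (n + e.+1)%N by exists (r - n.+1)%N; lia.
  have -> : (r - n = e.+1)%N by lia.
  rewrite hsym_newton.
  have dr : (e.+1 <= r.+1)%N by lia.
  rewrite (big_ord_widen r.+1 (fun i => x (j, i) * hsym (j, (e - i)%N)) dr).
  rewrite [RHS]big_mkcond; apply: eq_bigr => i _.
  case: (ltnP i e.+1) => id; last by rewrite ifF ?mulr0 //; lia.
  rewrite ifT; last by lia.
  by have -> : (r - i - n.+1 = e - i)%N by lia.
case: (ltnP n r.+1) => nr; last first.
  rewrite big1 ?add0r => [|i _].
    rewrite ifF; last by lia.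
    by rewrite mul0r scaler0 scaler0.
  by rewrite ifF ?scale0r //; have := ltn_ord i; lia.
rewrite (bigD1 (Ordinal nr)) //= eqxx big1 ?addr0 => [|i ni]; last first.
  rewrite ifF ?scale0r //; apply: contra_neqF ni => /eqP ni.
  exact/val_inj.
rewrite subSS scalerA mulrC (mulrC _ (c j)) -!scalerA -scalerDr; congr (_ *: _).
have -> : (r.+1 = n.+1 + (r - n))%N by lia.
rewrite natrD scalerDl; congr (_ + _); case: ltnP => nr'; first by rewrite scalerAl.
have -> : (r - n = 0)%N by lia.
by rewrite mul0r scale0r.
Qed.

Definition hweight k : int := \sum_(q <- k) Posz q.2.

Definition hspan (cs : seq I0) (w : int) : set B := lspan
  [set f | exists k, [/\ unzip1 k = cs, hweight k = w & f = hprod k]].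

Lemma subspace_hspan cs w : subspace (hspan cs w).
Proof. exact: subspace_lspan. Qed.

Lemma hspan_gen k : hspan (unzip1 k) (hweight k) (hprod k).
Proof. by apply: lspan_gen; exists k. Qed.

Lemma hspan_mul j r cs w f :
  hspan cs w f -> hspan (j :: cs) (Posz r + w) (hsym (j, r) * f).
Proof.
move: f; apply: lspan_min => [|_ [k [kcs kw ->]]].
  exact: (subspace_preim (lin_mul (hsym (j, r))) (subspace_hspan _ _)).
have -> : hsym (j, r) * hprod k = hprod ((j, r) :: k) by rewrite /hprod big_cons.
have -> : Posz r + w = hweight ((j, r) :: k) by rewrite /hweight big_cons -kw.
by rewrite -kcs; exact: (@hspan_gen ((j, r) :: k)).
Qed.

Lemma hspan_cat cs w f cs' w' g :
  hspan cs w f -> hspan cs' w' g -> hspan (cs ++ cs') (w + w') (f * g).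
Proof.
move=> Hf Hg; move: f Hf; apply: lspan_min => [|_ [k [<- <- ->]]].
  have := subspace_preim (lin_mul g) (subspace_hspan (cs ++ cs') (w + w')).
  by under eq_set => f do rewrite mulrC.
elim: k => [|[j r] k IH]; first by rewrite /hweight /hprod !big_nil add0r mul1r.
rewrite /hweight /hprod !big_cons /= -addrA -mulrA; exact: hspan_mul.
Qed.

Lemma hspan_series cs n : hspan cs (Posz n) ((\prod_(j <- cs) hseries j) n).
Proof.
elim: cs n => [|j cs IH] n.
  rewrite big_nil pser1; case: n => [|n]; last exact: (subspace_0 (subspace_hspan _ _)).
  have := @hspan_gen [::]; rewrite /hweight /hprod !big_nil; exact.
rewrite big_cons pserM; apply: (subspace_sum (subspace_hspan _ _)) => i _.
have -> : Posz n = Posz i + Posz (n - i) by have := ltn_ord i; lia.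
exact: (@hspan_mul j i _ _ _ (IH (n - i)%N)).
Qed.

Lemma hspan_neg cs w f : w < 0 -> hspan cs w f -> f = 0.
Proof.
move=> w0; move: f; apply: lspan_min => [|f [k [_ kw _]]]; first exact: subspace0.
suff : 0 <= hweight k by rewrite kw leNgt w0.
by apply: sumr_ge0.
Qed.

Lemma hspan_deriv (d : B -> B) (c : I0 -> F) n : linear d -> d 1 = 0 ->
  (forall q f, d (x q * f) =
     (if q.2 == n then n.+1%:R * c q.1 else 0) *: f + x q * d f) ->
  forall cs w f, hspan cs w f -> hspan cs (w - Posz n.+1) (d f).
Proof.
move=> dlin d1 dx cs w; apply: lspan_min => [|_ [k [<- <- ->]]].
  exact: (subspace_preim dlin (subspace_hspan _ _)).
elim: k => [|[j r] k IH].
  rewrite /hprod big_nil d1; exact: (subspace_0 (subspace_hspan _ _)).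
rewrite /hprod /hweight !big_cons (hsym_deriv dlin dx) /=.
apply: (subspaceD (subspace_hspan _ _)).
  apply: (subspaceZ (subspace_hspan _ _)); case: ltnP => nr; last first.
    by rewrite mul0r; apply: (subspace_0 (subspace_hspan _ _)).
  have -> : Posz r + hweight k - Posz n.+1 = Posz (r - n.+1) + hweight k by lia.
  exact: (@hspan_mul j (r - n.+1)%N _ _ _ (@hspan_gen k)).
by rewrite -addrA; apply: hspan_mul.
Qed.

End CompleteSymmetric.

Section NewtonTransfer.
Variables (F : fieldType) (I0 : eqType).
Hypothesis char0 : [pchar F] =i pred0.
Local Notation I := (I0 * nat)%type.
Variables (B : comAlgType F) (x : I -> B) (C : comAlgType F) (y : I -> C) (N : I -> C).
Implicit Types (f g : B) (q : I) (k : seq I).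

Hypothesis yN : forall j n,
  n.+1%:R *: y (j, n.+1) = \sum_(r < n.+1) N (j, r : nat) * y (j, (n - r)%N).

Variable phi : B -> C.
Hypothesis phi_linear : linear phi.
Hypothesis phiN : forall q f, phi (x q * f) = N q * phi f.

Lemma hsym_transfer j n f : phi (hsym x (j, n) * f) * y (j, 0%N) = y (j, n) * phi f.
Proof.
move: n f; apply: hsym_ind => [f|n f IH]; first by rewrite (hsym0 char0) mul1r mulrC.
apply: (scalerI (natr_neq0 char0 n)).
rewrite !scalerAl -(linZ phi_linear) (hsym_newton_mul char0) yN (lin_sum phi_linear).
rewrite !mulr_suml; apply: eq_bigr => r _.
by rewrite phiN -!mulrA IH // ltnS leq_subr.
Qed.

Lemma hprod_transfer k : phi (hprod x k) * \prod_(q <- k) y (q.1, 0%N) =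
  (\prod_(q <- k) y q) * phi 1.
Proof.
rewrite /hprod; elim: k => [|[j n] k IH]; first by rewrite !big_nil mul1r mulr1.
rewrite !big_cons [y _ * _]/= mulrA hsym_transfer -!mulrA; congr (_ * _).
exact: IH.
Qed.

End NewtonTransfer.

Section NewtonSolve.
Variables (F : fieldType) (C : comAlgType F) (y : nat -> C).
Hypothesis y0 : y 0%N = 1.

Fixpoint newton_seq n : seq C :=
  if n is m.+1 then
    let s := newton_seq m in
    rcons s (m.+1%:R *: y m.+1 - \sum_(r < m) nth 0 s r * y (m - r)%N)
  else [::].

Lemma newton_solve : exists N : nat -> C, forall n,
  n.+1%:R *: y n.+1 = \sum_(r < n.+1) N r * y (n - r)%N.
Proof.
have sz n : size (newton_seq n) = n by elim: n => //= n IH; rewrite size_rcons IH.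
have st n m r : (r < n)%N -> nth 0 (newton_seq (n + m)) r = nth 0 (newton_seq n) r.
  move=> rn; elim: m => [|m IH]; first by rewrite addn0.
  by rewrite addnS /= nth_rcons sz ifT ?IH //; lia.
exists (fun r => nth 0 (newton_seq r.+1) r) => n.
rewrite big_ord_recr subnn y0 mulr1.
rewrite [newton_seq n.+1]/= nth_rcons sz ltnn eqxx.
rewrite [X in _ = X + _](_ : _ = \sum_(r < n) nth 0 (newton_seq n) r * y (n - r)%N).
  by rewrite [RHS]addrC subrK.
apply: eq_bigr => r _; congr (_ * _).
by rewrite -[newton_seq n](congr1 newton_seq (subnKC (ltn_ord r))) st.
Qed.

End NewtonSolve.

Section ShiftedSeries.
Variables (F : fieldType) (I0 : eqType).
Hypothesis char0 : [pchar F] =i pred0.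
Local Notation I := (I0 * nat)%type.
Variables (B : comAlgType F) (x : I -> B) (delta : I0 -> bool).
Implicit Types (f g : B) (q : I) (k : seq I).

(* x^(n - delta) times the n-th divided derivative of x^delta H_j(x) *)
Definition dser q : pser B :=
  fun M => hseries x q.1 M *+ 'C(M + delta q.1, q.2).

(* x^(n+1) times the n-th divided derivative of sum_(i >= 0) x_(j,i) x^i + delta / x *)
Definition cser q : pser B := fun M =>
  if M is i.+1 then x (q.1, i) *+ 'C(i, q.2)
  else ((-1) ^+ q.2 * (delta q.1)%:R) *: 1.

Lemma alternating_binomial M (k : nat) :
  \sum_(r < k.+1) (-1) ^+ r * ('C(M.+1, k - r))%:R = ('C(M, k))%:R :> F.
Proof.
elim: k => [|k IH]; first by rewrite big_ord1 !bin0 mulr1.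
rewrite big_ord_recl mul1r subn0 binS natrD.
under eq_bigr => r _ do rewrite lift0 exprS mulN1r subSS mulNr.
by rewrite sumrN IH addrK.
Qed.

Lemma dser_newton j n :
  n.+1%:R *: dser (j, n.+1) = \sum_(r < n.+1) cser (j, r : nat) * dser (j, (n - r)%N).
Proof.
apply/funext => M; rewrite pserZ pser_sum.
under [RHS]eq_bigr => r _ do rewrite pserM big_ord_recl subn0.
rewrite big_split exchange_big -[RHS]/(_ + _).
set d := delta j; set H := hseries x j.
have -> : \sum_(r < n.+1) ((-1) ^+ r * d%:R) *: 1 * dser (j, (n - r)%N) M =
    (if d then H M *+ 'C(M, n) else 0).
  under eq_bigr => r _ do rewrite -scalerAl mul1r /dser /= -/d -/H -scaler_nat scalerA.
  rewrite -scaler_suml; case: d => /=; last first.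
    by rewrite big1 ?scale0r // => r _; rewrite mulr0 mul0r.
  rewrite -scaler_nat -alternating_binomial; congr (_ *: _).
  by apply: eq_bigr => r _; rewrite mulr1 addn1.
have -> : \sum_(i < M) \sum_(r < n.+1)
     cser (j, r : nat) (lift ord0 i) * dser (j, (n - r)%N) (M - lift ord0 i)%N =
   (\sum_(i < M) x (j, i : nat) * H (M.-1 - i)%N) *+ 'C(M.-1 + d, n).
  rewrite -sumrMnl; apply: eq_bigr => i _.
  under eq_bigr => r _.
    rewrite lift0 /cser /dser /= -/d -/H mulrnAl mulrnAr -mulrnA; over.
  rewrite /= sumrMnr; congr (_ * H _ *+ _); first by lia.
  have -> : (M.-1 + d = i + (M - i.+1 + d))%N by have := ltn_ord i; lia.
  by rewrite -binomial.Vandermonde; apply: eq_bigr => r _; rewrite mulnC.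
case: M => [|M].
  rewrite big_ord0 mul0rn addr0 /dser /= -/d -/H.
  case: d => /=; last by rewrite mulr0n scaler0.
  case: n => [|n]; first by rewrite scale1r.
  by rewrite bin_small // bin0n !mulr0n scaler0.
have -> : \sum_(i < M.+1) x (j, i : nat) * H (M.+1.-1 - i)%N = M.+1%:R *: H M.+1.
  by rewrite -[H M.+1]/(hsym x (j, M.+1)) (hsym_newton char0).
rewrite /dser [(j, _).1]/= [(j, _).2]/= -/d -/H -[X in X *+ 'C(M.+1 + d, _)]/(H M.+1).
rewrite -!scaler_nat !scalerA.
case: d => /=; last first.
  rewrite add0r; congr (_ *: _); rewrite !addn0 -!natrM.
  by rewrite -(mul_bin_diag M.+1) mulnC.
rewrite -scalerDl; congr (_ *: _); rewrite -!natrM -natrD; congr (_%:R).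
by rewrite !addn1 -(mul_bin_diag M.+2) /=; lia.
Qed.

Definition hshift q : B := if (delta q.1 <= q.2)%N then hsym x (q.1, (q.2 - delta q.1)%N) else 0.

Lemma low_term_dser q : low_term (dser q) (Posz q.2 - Posz (delta q.1)) (hshift q).
Proof.
case: q => j n; rewrite /low_term /hshift /dser /=; set d := (delta j : nat).
split=> [[M|M] //= MnD|]; first by rewrite bin_small //; lia.
case: leqP => dn.
  have -> : Posz n - Posz d = Posz (n - d) by lia.
  by rewrite /= subnK // binn.
by have -> : Posz n - Posz d = Negz (d - n.+1) by lia.
Qed.

Lemma low_term_prod_dser k : low_term (\prod_(q <- k) dser q)
  (\sum_(q <- k) (Posz q.2 - Posz (delta q.1))) (\prod_(q <- k) hshift q).
Proof.
elim: k => [|q k IH]; first by rewrite !big_nil; split=> [[n|n]|].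
by rewrite !big_cons; apply: low_termM => //; apply: low_term_dser.
Qed.

(* x^(-n-1) times the part of [cser] coming from the negative modes *)
Definition nser q : pser B := fun m => x (q.1, (m + q.2)%N) *+ 'C(m + q.2, q.2).

Lemma pcoef_cser_mul j n (G : pser B) s : pcoef (cser (j, n) * G) s =
  pcoef (nser (j, n) * G) (s - Posz n.+1)
  + ((-1) ^+ n * (delta j)%:R) *: pcoef G s.
Proof.
case: s => [s|s]; last first.
  have -> : Negz s - Posz n.+1 = Negz (s + n.+1) by lia.
  by rewrite /= scaler0 addr0.
rewrite /= pserM big_ord_recl subn0 addrC; congr (_ + _); last by rewrite -scalerAl mul1r.
under eq_bigr => i _ do rewrite lift0 /=.
have [ns|sn] := leqP n.+1 s; last first.
  have -> : Posz s - Posz n.+1 = Negz (n - s) by lia.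
  rewrite /= big1 // => i _; rewrite bin_small ?mulr0n ?mul0r //.
  by have := ltn_ord i; lia.
have -> : Posz s - Posz n.+1 = Posz (s - n.+1) by lia.
rewrite /= pserM -(big_mkord xpredT (fun i => x (j, i) *+ 'C(i, n) * G (s - i.+1)%N)).
rewrite (big_cat_nat _ (n := n)) //=; last by lia.
rewrite big_nat big1 ?add0r => [|i /andP[_ ni]]; last by rewrite bin_small // mul0r.
rewrite -{1}[n]add0n big_addn.
have -> : (s - n = (s - n.+1).+1)%N by lia.
rewrite big_mkord; apply: eq_bigr => i _; congr (_ * G _); lia.
Qed.

End ShiftedSeries.

(** * The Fock space as a polynomial ring *)

Section Fock.
Variables (F : fieldType) (l : nat).
Hypothesis char0 : [pchar F] =i pred0.

Local Notation I := ('I_l * nat)%type.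
Local Notation fock := {malg F[{cmonom I}]}.
Implicit Types (f g : fock) (q : I) (m : {cmonom I}) (k : seq I).

Definition mon : {cmonom I} -> fock := locked_with lext_key (fun m => << m >>).
Definition mcons : I -> {cmonom I} -> {cmonom I} :=
  locked_with lext_key (fun q m => mmul (ucm q) m).

Definition mdel : I -> {cmonom I} -> {cmonom I} :=
  locked_with lext_key (fun q m => divcm m (ucm q)).

Lemma monE m : mon m = << m >>.
Proof. by rewrite /mon unlock. Qed.

Lemma mconsE q m : mcons q m = mmul (ucm q) m.
Proof. by rewrite /mcons unlock. Qed.

Lemma mdelE q m : mdel q m = divcm m (ucm q).
Proof. by rewrite /mdel unlock. Qed.

Lemma mconsK q : cancel (mcons q) (mdel q).
Proof.
move=> m; apply/eqP/cmP => p; rewrite mdelE mconsE divcmE cmM; lia.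
Qed.

Lemma mdelK q m : m q != 0%N -> mcons q (mdel q m) = m.
Proof.
move=> mq; apply/eqP/cmP => p; rewrite mconsE mdelE cmM divcmE ucmE.
by case: eqP => [<-|_]; rewrite ?subn0 ?add0n //; lia.
Qed.

Lemma mdel_mcons q p m : m p != 0%N -> mdel p (mcons q m) = mcons q (mdel p m).
Proof.
move=> mp; apply/eqP/cmP => r; rewrite !(mdelE, mconsE) !(divcmE, cmM, ucmE).
case: (eqVneq p r) => [pr|_]; last by rewrite subn0 subn0.
by rewrite -pr addnBA // lt0n.
Qed.

Lemma lext_mon (M : lmodType F) (G : {cmonom I} -> M) m : lext G (mon m) = G m.
Proof. by rewrite monE; exact: lextU. Qed.

Lemma fock_linear_ext (M : lmodType F) (G G' : fock -> M) :
  linear G -> linear G' -> (forall m, G (mon m) = G' (mon m)) -> G =1 G'.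
Proof. by move=> lG lG' E; apply: malg_linear_ext => // m; rewrite -monE. Qed.

Definition fvar q : fock := mon (ucm q).

Lemma fvarU q m : fvar q * mon m = mon (mcons q m).
Proof. by rewrite /fvar !monE mconsE malgM_def fgmulUU mulr1. Qed.

Lemma mon1 : mon mone = 1.
Proof. by rewrite monE. Qed.

Lemma count_fock_seq m q : count_mem q (fock_seq m) = m q.
Proof.
rewrite /fock_seq count_flatten -map_comp sumnE big_map.
under eq_bigr => p _ do rewrite /= count_nseq /=.
case: (boolP (q \in finsupp m)) => qm.
  rewrite (bigD1_seq q) ?fset_uniq //= eqxx mul1n big1 ?addn0 // => p.
  by move/negPf => ->.
rewrite big1_seq => [|p /= pm]; first by move: qm; rewrite -cmE_eq0 => /eqP.
by case: eqP => // pq; move: pm qm; rewrite pq => ->.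
Qed.

Lemma fock_seq_mul q m : perm_eq (fock_seq (mcons q m)) (q :: fock_seq m).
Proof.
apply/allP => p _ /=; apply/eqP.
by rewrite !count_fock_seq mconsE cmM ucmE.
Qed.

Lemma fock_seq1 : fock_seq mone = [::] :> seq I.
Proof. by rewrite /fock_seq mdom1. Qed.

Definition mext (B : comAlgType F) (G : I -> B) : fock -> B :=
  lext (fun m => \prod_(q <- fock_seq m) G q).

Lemma mext_linear (B : comAlgType F) (G : I -> B) : linear (mext G).
Proof. exact: lext_linear. Qed.

Lemma mext_var (B : comAlgType F) (G : I -> B) q f :
  mext G (fvar q * f) = G q * mext G f.
Proof.
move: f; apply: fock_linear_ext => [||m].
- exact: (lin_comp (lin_mul (fvar q)) (mext_linear G)).
- exact: (lin_comp (mext_linear G) (lin_mul (G q))).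
rewrite fvarU /mext !lext_mon (perm_big _ (fock_seq_mul q m)). by rewrite big_cons.
Qed.

Lemma mext1 (B : comAlgType F) (G : I -> B) : mext G 1 = 1.
Proof. by rewrite -mon1 /mext lext_mon fock_seq1 big_nil. Qed.

(* h(n+1) acting on M(1), where [c j] is <h, alpha_j> *)
Definition fder (c : 'I_l -> F) (n : nat) : fock -> fock :=
  lext (fun m => \sum_(j < l) (n.+1%:R * c j * (m (j, n))%:R) *:
                   mon (mdel (j, n) m)).

Lemma fder_linear c n : linear (fder c n).
Proof. exact: lext_linear. Qed.

Lemma fder1 c n : fder c n 1 = 0.
Proof.
rewrite -mon1 /fder lext_mon big1 // => j _; rewrite cm1 mulr0 scale0r //.
Qed.

Lemma fder_term (a : F) q p m :
  (a * (mcons q m p)%:R) *: mon (mdel p (mcons q m)) =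
  (a * (q == p)%:R) *: mon m + fvar q * ((a * (m p)%:R) *: mon (mdel p m)).
Proof.
have E : mcons q m p = ((q == p) + m p)%N by rewrite mconsE cmM ucmE.
rewrite -scalerAr fvarU E; case: (eqVneq (m p) 0%N) => [->|mp].
  rewrite mulr0 scale0r addr0 addn0.
  by case: eqP => [->|_]; [rewrite mconsK|rewrite mulr0 !scale0r].
rewrite (mdel_mcons _ mp) natrD mulrDr scalerDl.
case: (eqVneq q p) => [->|_]; [by rewrite (mdelK mp)|by rewrite mulr0 !scale0r].
Qed.

Lemma fder_var c n q f : fder c n (fvar q * f) =
  (if q.2 == n then n.+1%:R * c q.1 else 0) *: f + fvar q * fder c n f.
Proof.
move: f; apply: fock_linear_ext => [||m].
- exact: (lin_comp (lin_mul (fvar q)) (fder_linear c n)).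
- apply: (lin_add (f := fun f => _ *: f)); first by move=> a u v; rewrite scalerDr !scalerA mulrC.
  exact: (lin_comp (fder_linear c n) (lin_mul (fvar q))).
rewrite fvarU /fder !lext_mon mulr_sumr.
transitivity (\sum_(j < l) ((n.+1%:R * c j * (q == (j, n))%:R) *: mon m
   + fvar q * ((n.+1%:R * c j * (m (j, n))%:R) *: mon (mdel (j, n) m)))).
  by apply: eq_bigr => j _; apply: fder_term.
rewrite big_split /=; congr (_ + _).
have <- : \sum_(j < l) (n.+1%:R * c j * (q == (j, n))%:R) =
    if q.2 == n then n.+1%:R * c q.1 else 0.
  case: q => i r /=; case: eqP => [->|rn].
    rewrite (bigD1 i) //= eqxx mulr1 big1 ?addr0 // => j ji.
    by rewrite xpair_eqE eq_sym (negPf ji) mulr0.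
  rewrite big1 // => j _; rewrite xpair_eqE andbC.
  by case: eqP => // _; rewrite mulr0.
by rewrite scaler_suml.
Qed.

End Fock.

(** * The weight lattice *)

Section WeightLattice.
Variables (F : fieldType) (l : nat) (D : ade_algebra F l).
Hypothesis char0 : [pchar F] =i pred0.
Local Notation g := (lie D).
Local Notation P := (weight l).
Implicit Types (b : P) (cs : seq 'I_l).

Lemma intr_inj0 : injective (fun k : int => k%:~R : F).
Proof.
move=> m n /eqP; rewrite -subr_eq0 -intrB => mn.
suff : m - n == 0 by rewrite subr_eq0 => /eqP.
move: mn; case: (m - n) => [k|k]; first by move/pcharf0P: char0 => c0; rewrite -[k%:~R]/(k%:R) c0.
by rewrite NegzE mulrNz oppr_eq0 -[k.+1%:~R]/(k.+1%:R) (negPf (natr_neq0 char0 k)).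
Qed.

Lemma form_linr (x : g) : linear (form x : g -> F^o).
Proof. exact: form_lin. Qed.

Lemma form_linl (x : g) : linear ((fun y => form y x) : g -> F^o).
Proof. by move=> c y z; rewrite !(form_sym _ x) form_linr. Qed.

Lemma wt0 : wt D 0 = 0.
Proof. by rewrite /wt big1 // => i _; rewrite mxE mulr0z. Qed.

Lemma wtD (a b : P) : wt D (a + b) = wt D a + wt D b.
Proof. by rewrite /wt -big_split; apply: eq_bigr => i _; rewrite mxE mulrzDr. Qed.

Lemma wt_csa (a : P) : wt D a \in csa D.
Proof.
by apply: memv_suml => i _; rewrite -scaler_int; apply/memvZ/fwt_csa.
Qed.

Lemma csa_sroot (x : g) : x \in csa D -> exists c : 'I_l -> F, x = \sum_i c i *: sroot D i.
Proof.
move=> xh; have := xh; rewrite -(span_basis (sroot_basis D)) span_def big_image.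
move=> /memv_sumP [v vs ->].
have vc i : exists c : F, v i == c *: sroot D i.
  by have /vlineP [c ->] := vs i isT; exists c.
exists (fun i => xchoose (vc i)); apply: eq_bigr => i _.
exact/eqP/(xchooseP (vc i)).
Qed.

Lemma form_fwt_sum (c : 'I_l -> F) i : form (fwt D i) (\sum_j c j *: sroot D j) = c i.
Proof.
rewrite (lin_sum (form_linr _)) (bigD1 i) //= (linZ (form_linr _)) fwtE eqxx.
rewrite big1 => [|j /negPf ji]; first by rewrite addr0 -[LHS]/(_ * _) mulr1.
by rewrite (linZ (form_linr _)) fwtE eq_sym ji scaler0.
Qed.

Lemma csa_nondegenerate (x : g) :
  x \in csa D -> (forall j, form x (sroot D j) = 0) -> x = 0.
Proof.
move=> /csa_sroot [c ->] xs; rewrite big1 // => i _.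
have [d dE] := csa_sroot (fwt_csa D i).
suff -> : c i = 0 by rewrite scale0r.
rewrite -(form_fwt_sum c i) form_sym {1}dE (lin_sum (form_linr _)).
by rewrite big1 // => j _; rewrite (linZ (form_linr _)) xs scaler0.
Qed.

Lemma form_wt_sroot b j : form (wt D b) (sroot D j) = (b 0 j)%:~R.
Proof.
rewrite /wt (lin_sum (form_linl _)) (bigD1 j) //= -scaler_int (linZ (form_linl _)).
rewrite fwtE eqxx big1 => [|i /negPf ij].
  by rewrite addr0 -[LHS]/(_ * _) mulr1.
by rewrite -scaler_int (linZ (form_linl _)) fwtE ij scaler0.
Qed.

Lemma sroot_csa j : sroot D j \in csa D.
Proof.
by rewrite -(span_basis (sroot_basis D)); apply/memv_span; apply: fintype.image_f.
Qed.

Lemma wt_alpha j : wt D (alpha D j) = sroot D j.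
Proof.
apply/eqP; rewrite -subr_eq0; apply/eqP/csa_nondegenerate.
  by apply: memvB; [apply: wt_csa|apply: sroot_csa].
move=> i; rewrite (linD (form_linl _)) -scaleN1r (linZ (form_linl _)) scaleN1r.
by rewrite form_wt_sroot mxE cartanE subrr.
Qed.

Definition rt cs : P := \sum_(j <- cs) alpha D j.

Lemma rt_nil : rt [::] = 0. Proof. by rewrite /rt big_nil. Qed.
Lemma rt_cons j cs : rt (j :: cs) = alpha D j + rt cs.
Proof. by rewrite /rt big_cons. Qed.
Lemma rt_cat cs cs' : rt (cs ++ cs') = rt cs + rt cs'.
Proof. by rewrite /rt big_cat. Qed.

Lemma wt_rt cs : wt D (rt cs) = \sum_(j <- cs) sroot D j.
Proof.
elim: cs => [|j cs IH]; first by rewrite rt_nil wt0 big_nil.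
by rewrite rt_cons wtD IH wt_alpha big_cons.
Qed.

Lemma form_rt_wt cs b : form (wt D (rt cs)) (wt D b) = (\sum_(j <- cs) b 0 j)%:~R.
Proof.
rewrite wt_rt (lin_sum (form_linl _)); elim: cs => [|j cs IH].
  by rewrite !big_nil.
by rewrite !big_cons IH form_sym form_wt_sroot intrD.
Qed.

Lemma form_rt_fwt cs j : form (wt D (rt cs)) (fwt D j) = (count_mem j cs)%:R.
Proof.
rewrite wt_rt (lin_sum (form_linl _)); elim: cs => [|i cs IH]; first by rewrite big_nil.
by rewrite big_cons IH form_sym fwtE /= natrD eq_sym.
Qed.

End WeightLattice.

(** * Operators on V_P *)

Section Operators.
Variables (F : fieldType) (l : nat) (D : ade_algebra F l).
Variable eps : weight l -> weight l -> F.
Hypothesis char0 : [pchar F] =i pred0.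
Local Notation g := (lie D).
Local Notation P := (weight l).
Local Notation I := ('I_l * nat)%type.
Local Notation fock := {malg F[{cmonom I}]}.
Local Notation VP := (VP F l).
Implicit Types (b c : P) (cs : seq 'I_l) (f : fock) (v w : VP).

Definition tens b : fock -> VP := lext (fun m => bas F (m, b)).

Lemma tens_linear b : linear (tens b).
Proof. exact: lext_linear. Qed.

Lemma tens_mon b m : tens b (mon F m) = bas F (m, b).
Proof. exact: lext_mon. Qed.

Lemma tens1 b : tens b 1 = expv F b.
Proof. by rewrite -mon1 tens_mon. Qed.

Lemma lin_ext_linear (M : lmodType F) (G : fock_monom l * P -> M) : linear (lin_ext G).
Proof.
move=> a v w; have E u : lin_ext G u = lext G u by rewrite lextE.
by rewrite !E lext_linear.
Qed.

Lemma lin_ext_bas (M : lmodType F) (G : fock_monom l * P -> M) d :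
  lin_ext G (bas F d) = G d.
Proof.
have E u : lin_ext G u = lext G u by rewrite lextE.
by rewrite E lextU.
Qed.

Lemma VP_subspace (S : set VP) : subspace S -> (forall d, S (bas F d)) -> forall v, S v.
Proof. exact: malg_subspace. Qed.

Lemma heis_linear (h : g) n : linear (heis h n).
Proof. by case: n => [[|n]|n]; apply: lin_ext_linear. Qed.

Lemma e_op_linear b : linear (e_op eps b).
Proof. exact: lin_ext_linear. Qed.

Lemma xpow_linear b k : linear (xpow D b k).
Proof. exact: lin_ext_linear. Qed.

Lemma heis_neg (h : g) n b f : heis h (Negz n) (tens b f) =
  tens b (\sum_j form h (fwt D j) *: (fvar F (j, n) * f)).
Proof.
move: f; apply: fock_linear_ext => [||m].
- exact: (lin_comp (tens_linear b) (heis_linear h (Negz n))).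
- apply: lin_comp (tens_linear b) => c f f'.
  rewrite scaler_sumr -big_split; apply: eq_bigr => j _.
  by rewrite mulrDr scalerDr -!scalerAr !scalerA mulrC.
rewrite tens_mon /heis /= lin_ext_bas (lin_sum (tens_linear b)).
apply: eq_bigr => j _; rewrite (linZ (tens_linear b)) fvarU tens_mon.
by rewrite mconsE.
Qed.

Lemma heis_pos (h : g) n b f : heis h (Posz n.+1) (tens b f) =
  tens b (fder (fun j => form h (sroot D j)) n f).
Proof.
move: f; apply: fock_linear_ext => [||m].
- exact: (lin_comp (tens_linear b) (heis_linear h (Posz n.+1))).
- exact: (lin_comp (fder_linear _ n) (tens_linear b)).
rewrite tens_mon /heis /= lin_ext_bas /fder lext_mon (lin_sum (tens_linear b)).
apply: eq_bigr => j _; rewrite (linZ (tens_linear b)) tens_mon.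
by rewrite mdelE.
Qed.

Lemma heis_zero (h : g) b f : heis h 0 (tens b f) = form h (wt D b) *: tens b f.
Proof.
move: f; apply: fock_linear_ext => [||m].
- exact: (lin_comp (tens_linear b) (heis_linear h 0)).
- by move=> c f f'; rewrite tens_linear scalerDr !scalerA mulrC.
by rewrite tens_mon /heis /= lin_ext_bas.
Qed.

Lemma e_op_tens c b f : e_op eps c (tens b f) = eps c b *: tens (c + b) f.
Proof.
move: f; apply: fock_linear_ext => [||m].
- exact: (lin_comp (tens_linear b) (e_op_linear c)).
- by move=> a f f'; rewrite tens_linear scalerDr !scalerA mulrC.
by rewrite !tens_mon /e_op lin_ext_bas.
Qed.

Definition pair_rt cs b : int := \sum_(j <- cs) b 0 j.

Lemma xpow_tens cs k b f :
  xpow D (rt D cs) k (tens b f) = if k == pair_rt cs b then tens b f else 0.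
Proof.
move: f; apply: fock_linear_ext => [||m].
- exact: (lin_comp (tens_linear b) (xpow_linear (rt D cs) k)).
- by case: (k == _) => a f f'; rewrite ?tens_linear ?scaler0 ?addr0.
rewrite !tens_mon /xpow lin_ext_bas /= form_rt_wt //.
by rewrite (inj_eq (intr_inj0 char0)) eq_sym.
Qed.

(* [sg] is 1 for a series in x, and -1 for a series in 1/x *)
Lemma iter_smul_low (A : opser F l) (sg : int) :
  (forall p, A p 0 = 0) -> (forall p v, sg * p <= 0 -> A p v = 0) ->
  forall n k v, sg * k < Posz n -> iter n (smul A) (sone (F := F) (l := l)) k v = 0.
Proof.
move=> A0 Alow; elim=> [|n IH] k v kn /=.
  rewrite /sone; case: eqP => // k0; move: kn; rewrite k0 mulr0 //.
rewrite /smul fsbig1 // => p _.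
have [p0|p0] := leP (sg * p) 0; first by rewrite Alow.
rewrite IH ?A0 //; rewrite mulrBr; lia.
Qed.

Lemma sexp_zero (A : opser F l) (sg : int) v :
  sg != 0 -> (forall p, A p 0 = 0) -> (forall p w, sg * p <= 0 -> A p w = 0) ->
  sexp A 0 v = v.
Proof.
move=> sg0 A0 Alow; rewrite /sexp (@fsum_one _ _ _ _ 0%N).
  by rewrite fact0 invr1 scale1r.
move=> n n0; rewrite (iter_smul_low A0 Alow) ?scaler0 // mulr0.
by case: n n0.
Qed.

Lemma sexp_low (A : opser F l) (sg : int) k v :
  (forall p, A p 0 = 0) -> (forall p w, sg * p <= 0 -> A p w = 0) ->
  sg * k < 0 -> sexp A k v = 0.
Proof.
move=> A0 Alow k0; rewrite /sexp fsbig1 // => n _.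
by rewrite (iter_smul_low A0 Alow) ?scaler0 //; lia.
Qed.

End Operators.

Lemma sum_count (F : fieldType) (M : lmodType F) (I : finType) (s : seq I) (y : I -> M) :
  \sum_i (count_mem i s)%:R *: y i = \sum_(i <- s) y i.
Proof.
elim: s => [|j s IH]; first by rewrite big_nil big1 // => i _; rewrite scale0r.
rewrite big_cons -IH.
under eq_bigr => i _ do rewrite /= natrD scalerDl.
rewrite big_split /= (bigD1 j) //= eqxx scale1r big1 ?addr0 // => i ij.
by rewrite eq_sym (negPf ij) scale0r.
Qed.

Section CreationSeries.
Variables (F : fieldType) (l : nat) (D : ade_algebra F l).
Variable eps : weight l -> weight l -> F.
Hypothesis char0 : [pchar F] =i pred0.
Local Notation g := (lie D).
Local Notation P := (weight l).
Local Notation I := ('I_l * nat)%type.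
Local Notation fock := {malg F[{cmonom I}]}.
Local Notation VP := (VP F l).
Local Notation x := (@fvar F l).
Implicit Types (b c : P) (cs : seq 'I_l) (f : fock) (v w : VP) (k : seq I).

Lemma smul_0 (A B : opser F l) n :
  (forall p, A p 0 = 0) -> (forall p, B p 0 = 0) -> smul A B n 0 = 0.
Proof. by move=> A0 B0; rewrite /smul fsbig1 // => p _; rewrite B0 A0. Qed.

Lemma sexp_0 (A : opser F l) n : (forall p, A p 0 = 0) -> sexp A n 0 = 0.
Proof.
move=> A0; rewrite /sexp fsbig1 // => m _.
suff -> : iter m (smul A) (sone (F := F) (l := l)) n 0 = 0 by rewrite scaler0.
elim: m n => [|m IH] n /=; first by rewrite /sone; case: ifP.
exact: smul_0.
Qed.

Lemma smul_mult (A B : opser F l) b (Q G : pser fock) v (s : int) :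
  (forall n f, A n (tens b f) = tens b (pcoef Q n * f)) ->
  (forall n, B n v = tens b (pcoef G (n + s))) ->
  forall n, smul A B n v = tens b (pcoef (Q * G) (n + s)).
Proof.
move=> AQ BG n; rewrite /smul.
have E p : A p (B (n - p) v) = tens b (pcoef Q p * pcoef G (n + s - p)).
  by rewrite BG AQ addrAC.
case ns: (n + s) => [m|m]; last first.
  rewrite fsbig1 => [|p _]; first by rewrite /= (lin0 (tens_linear b)).
  rewrite E ns; case: p => [p|p]; last by rewrite mul0r (lin0 (tens_linear b)).
  have -> : Negz m - Posz p = Negz (m + p) by lia.
  by rewrite mulr0 (lin0 (tens_linear b)).
rewrite (fsum_nat_int (n := m.+1)) => [|p].
  rewrite /= pserM (lin_sum (tens_linear b)); apply: eq_bigr => i _.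
  rewrite E ns /=; have -> : Posz m - Posz i = Posz (m - i) by have := ltn_ord i; lia.
  by [].
rewrite E ns; case: p => [p|p]; last by rewrite mul0r (lin0 (tens_linear b)).
move=> nz; exists p => //; rewrite ltnNge; apply/negP => mp; apply: nz.
have -> : Posz m - Posz p = Negz (p - m.+1) by lia.
by rewrite mulr0 (lin0 (tens_linear b)).
Qed.

Definition pconst f : pser fock := fun n => if n == 0%N then f else 0.

Lemma mul_pconst (Q : pser fock) f n : (Q * pconst f) n = Q n * f.
Proof.
rewrite pserM big_ord_recr /= /pconst subnn eqxx big1 ?add0r // => i _.
by rewrite ifF ?mulr0 //; have := ltn_ord i; lia.
Qed.

Lemma sexp_mult (A : opser F l) b (Q : pser fock) : Q 0%N = 0 ->
  (forall n f, A n (tens b f) = tens b (pcoef Q n * f)) ->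
  forall n f, sexp A n (tens b f) = tens b (pcoef (pexp Q) n * f).
Proof.
move=> Q0 AQ n f; rewrite /sexp.
have E m j : iter m (smul A) (sone (F := F) (l := l)) j (tens b f) =
    tens b (pcoef (Q ^+ m * pconst f) (j + 0)).
  elim: m j => [|m IH] j /=.
    rewrite expr0 mul1r addr0 /sone; case: j => [[|j]|j] //=; by rewrite (lin0 (tens_linear b)).
  by rewrite exprS -mulrA; apply: smul_mult.
case: n => [n|n]; last first.
  rewrite fsbig1 => [|m _]; first by rewrite mul0r (lin0 (tens_linear b)).
  by rewrite E addr0 (lin0 (tens_linear b)) scaler0.
rewrite (@fsum_seq _ _ _ (iota 0 n.+1)) ?iota_uniq // => [|m].
  rewrite -{1}[n.+1]subn0 -[iota _ _]/(index_iota 0 n.+1) big_mkord /pexp /=.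
  rewrite mulr_suml (lin_sum (tens_linear b)); apply: eq_bigr => m _.
  by rewrite E addr0 /= mul_pconst -scalerAl (linZ (tens_linear b)).
rewrite E addr0 [pcoef _ _]/= mul_pconst mem_iota add0n => nz; rewrite ltnNge; apply/negP => nm.
by apply: nz; rewrite pser_pow_low // mul0r (lin0 (tens_linear b)) scaler0.
Qed.

Lemma Eminus_tens cs n b f : Eminus D (rt D cs) n (tens b f) =
  tens b (pcoef (\prod_(j <- cs) hseries x j) n * f).
Proof.
have PE := is_exp_sum cs (hseriesP char0 x).
have <- : pexp (\sum_(j <- cs) plog x j) = \prod_(j <- cs) hseries x j.
  by apply: (is_exp_uniq char0 _ PE); apply: pexpP => //; case: PE.
apply: sexp_mult; first by case: PE.
move=> {f}m f; case: m => [[|m]|m]; [| |by rewrite /= mul0r (lin0 (tens_linear b))].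
  by rewrite /= pser_sum big1 // mul0r (lin0 (tens_linear b)).
have -> : - Posz m.+1 = Negz m by [].
rewrite [heis]lock /= -lock heis_neg.
rewrite NegzE mulrNz invrN opprK -(linZ (tens_linear b)); congr tens.
have -> : \sum_j form (wt D (rt D cs)) (fwt D j) *: (x (j, m) * f) =
    \sum_(j <- cs) x (j, m) * f.
  by rewrite -[RHS]sum_count; apply: eq_bigr => j _; rewrite form_rt_fwt.
rewrite pser_sum mulr_suml scaler_sumr.
by apply: eq_bigr => j _; apply: scalerAl.
Qed.

End CreationSeries.

(** * Spanning sets of the principal-like subspaces *)

Section PrincipalSubspaces.
Variables (F : fieldType) (l : nat) (D : ade_algebra F l).
Variable eps : weight l -> weight l -> F.
Hypothesis char0 : [pchar F] =i pred0.
Hypothesis eps_neq0 : forall b c, eps b c != 0.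
Local Notation g := (lie D).
Local Notation P := (weight l).
Local Notation I := ('I_l * nat)%type.
Local Notation fock := {malg F[{cmonom I}]}.
Local Notation VP := (VP F l).
Local Notation x := (@fvar F l).
Implicit Types (b c : P) (cs : seq 'I_l) (f : fock) (v w : VP) (k : seq I).

Definition tspan b cs (s : int) : set VP :=
  [set v | exists2 f, hspan x cs s f & v = tens b f].

Lemma subspace_tspan b cs s : subspace (tspan b cs s).
Proof.
split.
  exists 0; first exact: (subspace_0 (subspace_hspan _ _ _)).
  by rewrite (lin0 (tens_linear b)).
move=> c _ _ [f Hf ->] [f' Hf' ->]; exists (c *: f + f').
  exact: (subspaceP (subspace_hspan _ _ _)).
by rewrite tens_linear.
Qed.

Lemma tspan_neg b cs s v : s < 0 -> tspan b cs s v -> v = 0.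
Proof. by move=> s0 [f /(hspan_neg s0) -> ->]; rewrite (lin0 (tens_linear b)). Qed.

Lemma heis_tspan (h : g) n b cs s v :
  tspan b cs s v -> tspan b cs (s - Posz n.+1) (heis h (Posz n.+1) v).
Proof.
move=> [f Hf ->]; rewrite heis_pos; eexists; last by [].
apply: (hspan_deriv char0 (fder_linear _ n) (fder1 _ n) _ Hf).
exact: fder_var.
Qed.

Definition Eplus_ser c : opser F l := fun r v => let n := - r in
  if 0 < n then - (n%:~R)^-1 *: heis (wt D c) n v else 0.

Lemma Eplus_tspan c n b cs s v :
  tspan b cs s v -> tspan b cs (s + n) (Eplus D c n v).
Proof.
move=> Hv; rewrite -[Eplus D c]/(sexp (Eplus_ser c)) /sexp; set A := Eplus_ser c.
apply: (subspace_fsum (subspace_tspan _ _ _)) => m _.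
apply: (subspaceZ (subspace_tspan _ _ _)).
have HA p w s' : tspan b cs s' w -> tspan b cs (s' + p) (A p w).
  move=> Hw; rewrite /A /Eplus_ser; case: p => [[|p]|p]; 
    try exact: (subspace_0 (subspace_tspan _ _ _)).
  apply: (subspaceZ (subspace_tspan _ _ _)).
  have -> : s' + Negz p = s' - Posz p.+1 by lia.
  have -> : - Negz p = Posz p.+1 by lia.
  exact: heis_tspan.
elim: m n => [|m IH] n /=.
  rewrite /sone; case: eqP => [->|_]; first by rewrite addr0.
  exact: (subspace_0 (subspace_tspan _ _ _)).
rewrite /smul; apply: (subspace_fsum (subspace_tspan _ _ _)) => p _.
have -> : s + n = s + (n - p) + p by lia.
exact/HA/IH.
Qed.

Lemma Eplus_ser0 c p : Eplus_ser c p 0 = 0.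
Proof. by rewrite /Eplus_ser; case: ifP => // _; rewrite (lin0 (heis_linear _ _)) scaler0. Qed.

Lemma Eplus_low c n v : 0 < n -> Eplus D c n v = 0.
Proof.
move=> n0; apply: (@sexp_low _ _ (Eplus_ser c) (-1)) => [p|p w p0|]; first exact: Eplus_ser0.
  by rewrite /Eplus_ser ifF //; lia.
by lia.
Qed.

Lemma Eplus_zero c v : Eplus D c 0 v = v.
Proof.
apply: (@sexp_zero _ _ (Eplus_ser c) (-1)) => [//|p|p w p0]; first exact: Eplus_ser0.
by rewrite /Eplus_ser ifF //; lia.
Qed.

Lemma Eplus0 c n : Eplus D c n 0 = 0 :> VP.
Proof. by apply: (@sexp_0 _ _ (Eplus_ser c)) => p; exact: Eplus_ser0. Qed.

Lemma e_op_xpow cs n b f : e_op eps (rt D cs) (xpow D (rt D cs) n (tens b f)) =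
  if n == pair_rt cs b then eps (rt D cs) b *: tens (rt D cs + b) f else 0.
Proof.
rewrite xpow_tens //; case: ifP => _; first exact: e_op_tens.
exact: (lin0 (e_op_linear _ _)).
Qed.

Lemma Yexp_tens cs n b f : Yexp D eps (rt D cs) n (tens b f) =
  \sum_(p \in [set: int]) Eminus D (rt D cs) p
     (Eplus D (rt D cs) (n - pair_rt cs b - p)
        (tens (rt D cs + b) (eps (rt D cs) b *: f))).
Proof.
set X : opser F l := fun n v => e_op eps (rt D cs) (xpow D (rt D cs) n v).
have E q : smul (Eplus D (rt D cs)) X q (tens b f) = Eplus D (rt D cs)
    (q - pair_rt cs b) (tens (rt D cs + b) (eps (rt D cs) b *: f)).
  rewrite /smul (@fsum_one _ _ _ _ (q - pair_rt cs b)).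
    rewrite /X e_op_xpow ifT; last by apply/eqP; lia.
    by rewrite (linZ (tens_linear _)).
  move=> p pn; rewrite /X e_op_xpow ifF; first exact: Eplus0.
  by apply/negP => /eqP E; apply: pn; lia.
rewrite -[LHS]/(\sum_(p \in [set: int]) Eminus D (rt D cs) p
  (smul (Eplus D (rt D cs)) X (n - p) (tens b f))).
by apply: eq_fsbigr => p _; rewrite E addrAC.
Qed.

(* the entries (j, 0) of [k] contribute a factor 1, and only record the charge *)
Definition hvec (la : P) k : VP := tens (la + rt D (unzip1 k)) (hprod x k).

Definition hspace (la : P) : set VP := lspan [set v | exists k, v = hvec la k].

Lemma subspace_hspace la : subspace (hspace la).
Proof. exact: subspace_lspan. Qed.

Lemma hspace_tens la cs s f : hspan x cs s f -> hspace la (tens (la + rt D cs) f).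
Proof.
move: f; apply: lspan_min => [|_ [k [<- _ ->]]].
  exact: (subspace_preim (tens_linear _) (subspace_hspace _)).
by apply: lspan_gen; exists k.
Qed.

Lemma hvec_nil la : hvec la [::] = expv F la.
Proof. by rewrite /hvec rt_nil addr0 /hprod big_nil tens1. Qed.

Lemma xmode_hspace la cs m k : hspace la (xmode D eps (rt D cs) m (hvec la k)).
Proof.
rewrite /xmode /hvec Yexp_tens; apply: (subspace_fsum (subspace_hspace _)) => p _.
have : tspan (rt D cs + (la + rt D (unzip1 k))) (unzip1 k) (hweight k)
   (tens (rt D cs + (la + rt D (unzip1 k))) (eps (rt D cs) (la + rt D (unzip1 k)) *: hprod x k)).
  eexists; last by [].
  apply: (subspaceZ (subspace_hspan _ _ _)); exact: (@hspan_gen _ _ _ x k).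
move=> /(Eplus_tspan (rt D cs)) Ht.
have [f Hf ->] := Ht (- m - 1 - pair_rt cs (la + rt D (unzip1 k)) - p).
rewrite Eminus_tens // addrCA -rt_cat.
case: p {Ht} Hf => [p|p] Hf; last first.
  by rewrite mul0r (lin0 (tens_linear _)); exact: (subspace_0 (subspace_hspace _)).
apply: hspace_tens; apply: hspan_cat Hf; exact: hspan_series.
Qed.

Section Generation.
Variables (la : P) (U : set VP).
Hypothesis SU : subspace U.
Hypothesis U0 : U (expv F la).
Hypothesis UX : forall j m v, U v -> U (xmode D eps (alpha D j) m v).

Lemma hvec_step j n k : U (hvec la k) ->
  (forall k' m, unzip1 k' = unzip1 k -> hweight k' < hweight k ->
     U (hvec la ((j, m) :: k'))) ->
  U (hvec la ((j, n) :: k)).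
Proof.
move=> Uk IH.
have rtj : rt D [:: j] = alpha D j by rewrite /rt big_seq1.
set c0 := la + rt D (unzip1 k); set e := eps (alpha D j) c0.
set N := pair_rt [:: j] c0 + Posz n.
have := UX j (- N - 1) Uk; rewrite /xmode /hvec -rtj Yexp_tens.
have -> : - (- N - 1) - 1 = N by lia.
have -> : N - pair_rt [:: j] (la + rt D (unzip1 k)) = Posz n by rewrite /N /c0; lia.
rewrite -/c0 rtj -/e.
set v' := tens (alpha D j + c0) (e *: hprod x k).
pose G p := Eminus D (alpha D j) p (Eplus D (alpha D j) (Posz n - p) v').
rewrite -[X in U X -> _]/(\sum_(p \in [set: int]) G p).
have tv' : tspan (alpha D j + c0) (unzip1 k) (hweight k) v'.
  eexists; last by [].
  apply: (subspaceZ (subspace_hspan _ _ _)); exact: (@hspan_gen _ _ _ x k).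
have G0 p : Eminus D (alpha D j) p 0 = 0 :> VP.
  by rewrite -(lin0 (tens_linear c0)) -rtj Eminus_tens // mulr0.
have GU p : p <> Posz n -> U (G p).
  move=> pn; rewrite /G.
  have [lp|np] := ltP p (Posz n).
    rewrite Eplus_low; last by lia.
    by rewrite G0; exact: subspace_0 SU.
  have := Eplus_tspan (alpha D j) (Posz n - p) tv'; move=> [f Hf ->].
  rewrite -rtj Eminus_tens // rtj big_seq1.
  case: p pn np Hf => [p|p] pn np Hf; last by lia.
  move: f Hf; apply: lspan_min => [|_ [k' [k'k k'w ->]]].
    exact: (subspace_preim (lin_comp (lin_mul _) (tens_linear _)) SU).
  have := IH k' p k'k; rewrite /hvec /= rt_cons k'k addrCA /hprod big_cons.
  by apply; rewrite k'w; lia.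
rewrite (@fsum_seq _ _ _ [seq Posz (n + r) | r <- iota 0 `|hweight k|.+1]) => [||p].
- rewrite (bigD1_seq (Posz n)); last 2 first.
  + by rewrite /= addn0 mem_head.
  + by rewrite map_inj_uniq ?iota_uniq // => p q [] /addnI.
  move=> Us.
  have Gn : U (G (Posz n)).
    rewrite -[G _](addrK
      (\sum_(i <- [seq Posz (n + r) | r <- iota 0 `|hweight k|.+1] | i != Posz n) G i)).
    apply: (subspaceB SU) => //.
    rewrite -big_filter; apply: (subspace_sum SU) => p; rewrite mem_filter => /andP[/eqP pn _].
    exact: GU.
  move: Gn; rewrite /G subrr Eplus_zero /v' -rtj (Eminus_tens D char0) rtj big_seq1.
  rewrite -scalerAr (linZ (tens_linear _)) => /(subspaceZ SU e^-1).
  rewrite scalerA mulVf ?eps_neq0 // scale1r /c0 /= rt_cons addrCA /hprod big_cons.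
  by [].
- by rewrite map_inj_uniq ?iota_uniq // => p q [] /addnI.
- move=> Gp; have np : Posz n <= p.
    rewrite leNgt; apply/negP => pn; apply: Gp; rewrite /G Eplus_low; last by lia.
    exact: G0.
  have pk : p <= Posz n + hweight k.
    rewrite leNgt; apply/negP => pn; apply: Gp; rewrite /G.
    rewrite (tspan_neg _ (Eplus_tspan (alpha D j) (Posz n - p) tv')); first exact: G0.
    by lia.
  apply/mapP; exists (absz (p - Posz n)); first by rewrite mem_iota; lia.
  by lia.
Qed.

Lemma hspace_min v : hspace la v -> U v.
Proof.
move: v; apply: (lspan_min SU) => _ [k ->].
move: {2}(unzip1 k) (erefl (unzip1 k)) => cs; elim: cs k => [|j cs IHc] k.
  by case: k => // _; rewrite hvec_nil.
case: k => [|[j' n] k] //= [-> kcs] {j'}.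
move: {2}(absz (hweight k)) (leqnn (absz (hweight k))) => s.
have hw k' : 0 <= hweight k' by apply: sumr_ge0.
elim/ltn_ind: s k n kcs => s IHs k n kcs ks.
apply: hvec_step => [|k' m k'k k'w]; first exact: IHc.
apply: (IHs (absz (hweight k'))) => //; last by rewrite k'k.
by have := hw k; have := hw k'; lia.
Qed.

End Generation.

Lemma pos_root_rt b : pos_root D b -> exists cs, b = rt D cs.
Proof.
move=> [_ [c ->]]; exists (flatten [seq nseq (c i) i | i <- enum 'I_l]).
rewrite /rt big_flatten big_map big_enum; apply: eq_bigr => i _.
by rewrite big_nseq iter_addr_0.
Qed.

Lemma pos_root_alpha j : pos_root D (alpha D j).
Proof.
split; first by rewrite /root wt_alpha; exact: sroot_root.
exists (fun i => (i == j) : nat); rewrite (bigD1 j) //= eqxx big1 ?addr0 // => i.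
by move=> /negPf ->.
Qed.

Lemma W_hspace (X : affine_action D eps) la : W X la = hspace la.
Proof.
apply/seteqP; split=> v.
  apply; first exact: subspace_hspace.
    by apply: lspan_gen; exists [::]; rewrite hvec_nil.
  move=> y n w Hy Hw; move: y Hy; apply: lspan_min => [|_ [b Hb <-]].
    exact: (subspace_preim (gact_linl X n w) (subspace_hspace la)).
  move: w Hw; apply: lspan_min => [|_ [k ->]].
    exact: (subspace_preim (gact_linr X _ n) (subspace_hspace la)).
  rewrite gact_root; last by case: Hb.
  by have [cs ->] := pos_root_rt Hb; exact: xmode_hspace.
move=> Hv U SU U0 UX; apply: (hspace_min SU U0) Hv => j m w Uw.
rewrite -(gact_root X); last by case: (pos_root_alpha j).
by apply: UX => //; apply: lspan_gen; exists (alpha D j) => //; exact: pos_root_alpha.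
Qed.

End PrincipalSubspaces.

(** * The vertex operators of V_Q on e^la *)

Section VertexOperators.
Variables (F : fieldType) (l : nat) (D : ade_algebra F l).
Variable eps : weight l -> weight l -> F.
Hypothesis char0 : [pchar F] =i pred0.
Local Notation g := (lie D).
Local Notation P := (weight l).
Local Notation I := ('I_l * nat)%type.
Local Notation fock := {malg F[{cmonom I}]}.
Local Notation VP := (VP F l).
Local Notation x := (@fvar F l).
Implicit Types (b c : P) (cs : seq 'I_l) (f : fock) (v w : VP) (k : seq I).

Lemma iter_sder (A : opser F l) n s v :
  iter n (@sder F l) A s v = (\prod_(t < n) (s + Posz t.+1)%:~R) *: A (s + Posz n) v.
Proof.
elim: n s => [|n IH] s; first by rewrite big_ord0 scale1r addr0.
rewrite iterS -[LHS]/((s + 1)%:~R *: iter n (@sder F l) A (s + 1) v) IH scalerA.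
have -> : s + 1 + Posz n = s + Posz n.+1 by lia.
have E (t : 'I_n) : (s + 1 + Posz t.+1)%:~R = (s + Posz (lift ord0 t).+1)%:~R :> F.
  by rewrite lift0; have -> : s + 1 + Posz t.+1 = s + Posz t.+2 by lia.
by rewrite big_ord_recl (eq_bigr _ (fun t _ => E t)).
Qed.

Lemma prod_shift_bin m n :
  (\prod_(t < n) (m + t.+1))%N = (n`! * 'C(m + n, n))%N.
Proof.
elim: n => [|n IH]; first by rewrite big_ord0 bin0.
rewrite big_ord_recr /= IH factS; have := mul_bin_diag (m + n.+1) n.
by rewrite addnS /=; nia.
Qed.

Lemma prod_shift_fact n :
  \prod_(t < n) (- Posz n.+1 + Posz t.+1)%:~R = (-1) ^+ n * n`!%:R :> F.
Proof.
elim: n => [|n IH]; first by rewrite big_ord0 mul1r.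
rewrite big_ord_recl; under eq_bigr => t _.
  have -> : - Posz n.+2 + Posz (lift ord0 t).+1 = - Posz n.+1 + Posz t.+1.
    by rewrite lift0; lia.
  over.
rewrite IH factS natrM exprS /=.
have -> : - Posz n.+2 + 1 = - Posz n.+1 by lia.
by rewrite mulrNz -[n.+1%:~R]/(n.+1%:R : F) mulN1r !mulNr mulrCA.
Qed.

Lemma fact_neq0 n : (n`!%:R : F) != 0.
Proof. by have := natr_neq0 char0 (n`!).-1; rewrite prednK ?fact_gt0. Qed.

Lemma sroot_sum j (G : 'I_l -> fock) :
  \sum_i form (sroot D j) (fwt D i) *: G i = G j.
Proof.
rewrite (bigD1 j) //= form_sym fwtE eqxx scale1r big1 ?addr0 // => i /negPf ij.
by rewrite form_sym fwtE ij scale0r.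
Qed.

Lemma current_neg_tens j s b f :
  current_neg (sroot D j) s (tens b f) = if s is Posz m then tens b (x (j, m) * f) else 0.
Proof.
rewrite /current_neg; case: s => m.
  have -> : - Posz m - 1 = Negz m by lia.
  by rewrite [heis]lock /= -lock heis_neg (sroot_sum j (fun i => x (i, m) * f)).
have -> : - Negz m - 1 = Posz m by lia.
by [].
Qed.

Lemma sdivder_neg j n s b f : sdivder n (current_neg (sroot D j)) s (tens b f) =
  tens b (pcoef (nser x (j, n)) s * f).
Proof.
have C (m : nat) : (n`!%:R)^-1 * \prod_(t < n) (Posz m + Posz t.+1)%:~R = ('C(m + n, n))%:R :> F.
  have -> : \prod_(t < n) (Posz m + Posz t.+1)%:~R = (\prod_(t < n) (m + t.+1))%N%:R :> F.
    by rewrite natr_prod.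
  by rewrite prod_shift_bin natrM mulKf // fact_neq0.
rewrite /sdivder iter_sder; case: s => m.
  rewrite [X in current_neg _ X](_ : _ = Posz (m + n)) // current_neg_tens.
  have E : nser x (j, n) m * f = ('C(m + n, n))%:R *: (x (j, (m + n)%N) * f).
    by rewrite /nser mulrnAl scaler_nat.
  rewrite [pcoef _ _]/= E (linZ (tens_linear b)) -C -scalerA.
  by [].
rewrite current_neg_tens /pcoef mul0r (lin0 (tens_linear b)).
case E: (Negz m + Posz n) => [r|r]; last by rewrite !scaler0.
have mn : (m < n)%N by lia.
rewrite (bigD1 (Ordinal mn)) //=.
have -> : Negz m + Posz m.+1 = 0 by lia.
by rewrite mul0r scale0r scaler0.
Qed.

Lemma heis_exp_pos (h : g) n b (a : F) : heis h (Posz n.+1) (a *: expv F b) = 0.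
Proof.
rewrite (linZ (heis_linear _ _)) -tens1 heis_pos fder1 (lin0 (tens_linear _)).
by rewrite scaler0.
Qed.

Lemma current_pos_exp j s b (a : F) : current_pos (sroot D j) s (a *: expv F b) =
  if s == -1 then (a * (b 0 j)%:~R) *: expv F b else 0.
Proof.
rewrite /current_pos; case: s => m.
  have -> : - Posz m - 1 = Negz m by lia.
  by [].
have -> : - Negz m - 1 = Posz m by lia.
case: m => [|m]; last by rewrite [heis]lock /= -lock heis_exp_pos.
rewrite [heis]lock /= -lock (linZ (heis_linear _ _)) -tens1 heis_zero scalerA.
by rewrite form_sym form_wt_sroot.
Qed.

Lemma sdivder_pos j n s b (a : F) :
  sdivder n (current_pos (sroot D j)) s (a *: expv F b) =
  if s == - Posz n.+1 then (a * ((-1) ^+ n * (b 0 j)%:~R)) *: expv F b else 0.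
Proof.
rewrite /sdivder iter_sder current_pos_exp.
have -> : (s + Posz n == -1) = (s == - Posz n.+1) by apply/eqP/eqP; lia.
case: eqP => [->|_]; last by rewrite !scaler0.
rewrite prod_shift_fact !scalerA.
suff -> : (n`!%:R)^-1 * ((-1) ^+ n * n`!%:R) * (a * (b 0 j)%:~R) =
  a * ((-1) ^+ n * (b 0 j)%:~R) by [].
by rewrite [X in X * _]mulrCA mulVf ?fact_neq0 // mulr1 mulrCA.
Qed.

Lemma Yexp_exp cs s b (a : F) : Yexp D eps (rt D cs) s (a *: expv F b) =
  tens (rt D cs + b)
    (pcoef ((a * eps (rt D cs) b) *: \prod_(j <- cs) hseries x j) (s - pair_rt cs b)).
Proof.
rewrite -tens1 -(linZ (tens_linear b)) Yexp_tens //.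
rewrite (@fsum_one _ _ _ _ (s - pair_rt cs b)).
  rewrite subrr Eplus_zero Eminus_tens //; congr tens.
  rewrite scalerA -scalerAr mulr1 (mulrC a).
  by case: (s - _) => // m; rewrite scaler0.
move=> p ps; have t0 : tspan (rt D cs + b) [::] 0
    (tens (rt D cs + b) (eps (rt D cs) b *: (a *: 1))).
  eexists; last by [].
  do 2 apply: (subspaceZ (subspace_hspan _ _ _)).
  have := @hspan_gen _ _ _ x [::]; rewrite /hweight /hprod !big_nil; exact.
rewrite -[RHS](lin0 (tens_linear (rt D cs + b))).
have [lt0|ge0] := ltP 0 (s - pair_rt cs b - p).
  rewrite Eplus_low // -(lin0 (tens_linear (rt D cs + b))) Eminus_tens // mulr0 //.
rewrite (tspan_neg _ (Eplus_tspan D char0 (rt D cs) _ t0)); last by lia.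
by rewrite -(lin0 (tens_linear (rt D cs + b))) Eminus_tens // mulr0.
Qed.

End VertexOperators.

Section FusionMap.
Variables (F : fieldType) (l : nat) (D : ade_algebra F l).
Variable eps : weight l -> weight l -> F.
Hypothesis char0 : [pchar F] =i pred0.
Local Notation g := (lie D).
Local Notation P := (weight l).
Local Notation I := ('I_l * nat)%type.
Local Notation fock := {malg F[{cmonom I}]}.
Local Notation VP := (VP F l).
Local Notation x := (@fvar F l).
Implicit Types (b c : P) (cs : seq 'I_l) (f : fock) (v w : VP) (k : seq I).

Lemma Yexp_0 b n : Yexp D eps b n 0 = 0.
Proof.
have S0 (A : opser F l) : (forall p, A p 0 = 0) -> forall p, sexp A p 0 = 0.
  by move=> A0 p; exact: sexp_0.
have Em p : Eminus D b p 0 = 0 :> VP.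
  apply: S0 => q; rewrite [heis]lock /= -lock; case: ifP => // _.
  by rewrite (lin0 (heis_linear _ _)) scaler0.
apply: smul_0 => p; first exact: Em.
apply: smul_0 => q; first exact: Eplus0.
by rewrite (lin0 (xpow_linear _ _ _)) (lin0 (e_op_linear _ _)).
Qed.

Definition nords (s : seq I) (B : opser F l) : opser F l :=
  foldr (fun q B => nord (sroot D q.1) q.2 B) B s.

Lemma sdivder_0 n (A : opser F l) s : (forall p, A p 0 = 0) -> sdivder n A s 0 = 0.
Proof. by move=> A0; rewrite /sdivder iter_sder A0 !scaler0. Qed.

Lemma nords_0 s (B : opser F l) n : (forall p, B p 0 = 0) -> nords s B n 0 = 0.
Proof.
move=> B0; elim: s n => [|q s IH] n; first exact: B0.
rewrite -[LHS]/(smul (sdivder q.2 (current_neg (sroot D q.1))) (nords s B) n 0 +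
  smul (nords s B) (sdivder q.2 (current_pos (sroot D q.1))) n 0).
have cn p : current_neg (sroot D q.1) p (0 : VP) = 0.
  by rewrite /current_neg; case: ifP => // _; rewrite (lin0 (heis_linear _ _)).
have cp p : current_pos (sroot D q.1) p (0 : VP) = 0.
  by rewrite /current_pos; case: ifP => // _; rewrite (lin0 (heis_linear _ _)).
rewrite !smul_0 ?addr0 // => p; exact: sdivder_0.
Qed.

Lemma Ybas_nords d : Ybas D eps d = nords (fock_seq d.1) (Yexp D eps d.2).
Proof. by []. Qed.

Lemma Yop_linear n w : linear (fun v => Yop D eps v n w).
Proof. exact: lin_ext_linear. Qed.

Lemma Yop_0 v n : Yop D eps v n 0 = 0.
Proof.
move: v; apply: VP_subspace; first exact: (subspace_preim (Yop_linear n 0) (@subspace0 _ _)).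
move=> d; rewrite /= /Yop lin_ext_bas Ybas_nords; apply: nords_0 => p; exact: Yexp_0.
Qed.

Lemma Yc_trunc (u : 'I_l -> g) b v :
  (forall n, n < 0 -> Yop D eps v n (expv F b) = 0) ->
  Yc eps u b v = Yop D eps v 0 (expv F b).
Proof.
move=> Yn; pose A : opser F l := fun n v => if n == 1 then virasoro eps u (-1) v else 0.
have A0 p : A p 0 = 0 by rewrite /A; case: ifP => // _; exact: Yop_0.
have Al p w : 1 * p <= 0 -> A p w = 0 by rewrite /A; case: eqP => // ->.
rewrite -[LHS]/(\sum_(p \in [set: int])
  sexp A p ((-1) ^ (0 - p) *: Yop D eps v (0 - p) (expv F b))).
rewrite (@fsum_one _ _ _ _ (0 : int)).
  by rewrite (@sexp_zero _ _ A 1) // subrr expr0z scale1r.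
move=> p p0; have [lt0|ge0] := ltP p 0.
  by rewrite (@sexp_low _ _ A 1) // mul1r.
by rewrite Yn ?scaler0; [exact: sexp_0|lia].
Qed.

Variables (la : P) (delta : 'I_l -> bool).
Hypothesis la_delta : forall j, la 0 j = Posz (delta j).

Lemma pcoefZ (a : F) (p : pser fock) s : pcoef (a *: p) s = a *: pcoef p s.
Proof. by case: s => // s; rewrite scaler0. Qed.

Lemma pcoef_linear s : linear (fun p : pser fock => pcoef p s).
Proof. by move=> a p q; case: s => // s; rewrite /= scaler0 addr0. Qed.

Local Notation cserd := (cser x delta).
Local Notation dserd := (dser x delta).
Local Notation hprodE cs := (\prod_(j <- cs) hseries x j).

Lemma nords_exp s cs (a : F) n : nords s (Yexp D eps (rt D cs)) n (a *: expv F la) =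
  tens (rt D cs + la) (pcoef ((\prod_(q <- s) cserd q) *
     ((a * eps (rt D cs) la) *: hprodE cs))
     (n + (\sum_(q <- s) Posz q.2.+1 - pair_rt cs la))).
Proof.
elim: s a n => [|[j m] s IH] a n.
  by rewrite !big_nil mul1r add0r; exact: Yexp_exp.
pose B := nords s (Yexp D eps (rt D cs)).
rewrite -[LHS]/(smul (sdivder m (current_neg (sroot D j))) B n (a *: expv F la) +
  smul B (sdivder m (current_pos (sroot D j))) n (a *: expv F la)).
rewrite (smul_mult (fun n f => sdivder_neg D char0 j m n (rt D cs + la) f) (IH a)).
have -> : smul B (sdivder m (current_pos (sroot D j))) n (a *: expv F la) =
    B (n + Posz m.+1) ((a * ((-1) ^+ m * (la 0 j)%:~R)) *: expv F la).
  rewrite /smul (@fsum_one _ _ _ _ (n + Posz m.+1)).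
    rewrite sdivder_pos // ifT //; apply/eqP; lia.
  move=> p pn; rewrite sdivder_pos // ifF; last by apply/eqP; lia.
  apply: nords_0 => r; exact: Yexp_0.
rewrite /B IH -(linD (tens_linear (rt D cs + la))) !big_cons.
set e := eps _ _; set w := \sum_(q <- s) Posz q.2.+1 - pair_rt cs la.
rewrite -[_ + _ - pair_rt cs la]addrA -/w [(j, m).2]/=.
set Q := \prod_(q <- s) cserd q.
rewrite -[X in _ = tens _ (pcoef X _)]mulrA.
rewrite [in RHS](pcoef_cser_mul x delta j m).
have -> : n + (Posz m.+1 + w) - Posz m.+1 = n + w by lia.
rewrite -[n + Posz m.+1 + w]addrA.
have -> : (a * ((-1) ^+ m * (la 0 j)%:~R) * e) *: hprodE cs =
    ((-1) ^+ m * (delta j)%:R) *: ((a * e) *: hprodE cs).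
  rewrite scalerA la_delta -[(Posz _)%:~R]/((delta j)%:R : F).
  by have -> : a * ((-1) ^+ m * (delta j)%:R) * e = (-1) ^+ m * (delta j)%:R * (a * e)
    by rewrite mulrAC mulrC.
move: ((-1) ^+ m * _) => d; move: ((a * e) *: hprodE cs) => X.
by rewrite -(scalerAr d Q X) pcoefZ.
Qed.

Definition fweight (m : {cmonom I}) : int := \sum_(q <- fock_seq m) Posz q.2.+1.

Definition fhom (s : int) : set fock :=
  lspan [set f | exists2 m, fweight m = s & f = mon F m].

Lemma subspace_fhom s : subspace (fhom s).
Proof. exact: subspace_lspan. Qed.

Lemma fhom_var q s f : fhom s f -> fhom (Posz q.2.+1 + s) (x q * f).
Proof.
move: f; apply: lspan_min => [|_ [m <- ->]].
  exact: (subspace_preim (lin_mul (x q)) (subspace_fhom _)).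
rewrite fvarU; apply: lspan_gen; exists (mcons q m) => //.
by rewrite /fweight (perm_big _ (fock_seq_mul q m)) big_cons.
Qed.

Lemma fhom_hsym j n s f : fhom s f -> fhom (Posz n + s) (hsym x (j, n) * f).
Proof.
move: n f; apply: (hsym_ind (S := fun n f =>
  fhom s f -> fhom (Posz n + s) (hsym x (j, n) * f))) => [f|n f IH fs].
  by rewrite (hsym0 char0) mul1r add0r.
have -> : hsym x (j, n.+1) * f = (n.+1%:R^-1 : F) *: (n.+1%:R *: (hsym x (j, n.+1) * f)).
  by rewrite scalerA mulVf ?scale1r // natr_neq0.
apply: (subspaceZ (subspace_fhom _)); rewrite (hsym_newton_mul char0).
apply: (subspace_sum (subspace_fhom _)) => r _.
have -> : Posz n.+1 + s = Posz r.+1 + (Posz (n - r) + s) by have := ltn_ord r; lia.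
by apply: (@fhom_var (j, r : nat)); apply: IH => //; rewrite ltnS leq_subr.
Qed.

Lemma fhom_hprod k : fhom (hweight k) (hprod x k).
Proof.
rewrite /hweight /hprod; elim: k => [|[j n] k IH].
  rewrite !big_nil; apply: lspan_gen; exists mone; last by rewrite mon1.
  by rewrite /fweight fock_seq1 big_nil.
by rewrite !big_cons; exact: fhom_hsym.
Qed.

Local Notation rho := (mext cserd).

Lemma Yop_fhom cs n s f : fhom s f -> Yop D eps (tens (rt D cs) f) n (expv F la) =
  tens (rt D cs + la) (pcoef (rho f * (eps (rt D cs) la *: hprodE cs))
     (n + (s - pair_rt cs la))).
Proof.
move: f; apply: lspan_min => [|_ [m <- ->]].
  apply: (@subspace_eq _ _ _ (fun f => Yop D eps (tens (rt D cs) f) n (expv F la))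
    (fun f => tens (rt D cs + la) (pcoef (rho f * (eps (rt D cs) la *: hprodE cs))
     (n + (s - pair_rt cs la))))).
    exact: (lin_comp (tens_linear _) (Yop_linear n _)).
  apply: lin_comp (tens_linear _).
  apply: (lin_comp (g := fun p : pser fock => pcoef p _)) (pcoef_linear _) => a f f'.
  by rewrite mext_linear mulrDl scalerAl.
rewrite tens_mon /Yop lin_ext_bas Ybas_nords -[expv F la]scale1r nords_exp mul1r.
by rewrite /mext lext_mon.
Qed.

Lemma pair_rt_delta cs : pair_rt cs la = \sum_(j <- cs) Posz (delta j).
Proof. by apply: eq_bigr => j _. Qed.

Lemma Yop_hprod k n : Yop D eps (tens (rt D (unzip1 k)) (hprod x k)) n (expv F la) =
  eps (rt D (unzip1 k)) la *: tens (rt D (unzip1 k) + la)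
   (pcoef (\prod_(q <- k) dserd q) (n + \sum_(q <- k) (Posz q.2 - Posz (delta q.1)))).
Proof.
rewrite (Yop_fhom _ _ (@fhom_hprod k)) -scalerAr pcoefZ (linZ (tens_linear _)).
have dser0 j : dserd (j, 0%N) = hseries x j.
  by apply/funext => M; rewrite /dser bin0.
have E : rho (hprod x k) * hprodE (unzip1 k) = \prod_(q <- k) dserd q.
  have T := hprod_transfer char0 (dser_newton char0 x delta) (mext_linear _) (mext_var _) k.
  rewrite mext1 mulr1 in T; rewrite -[RHS]T big_map.
  by under [in RHS]eq_bigr => q _ do rewrite dser0.
rewrite E pair_rt_delta big_map /hweight.
by rewrite sumrB.
Qed.

Lemma Yop_hvec_low k n : n < 0 -> Yop D eps (hvec D 0 k) n (expv F la) = 0.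
Proof.
move=> n0; rewrite /hvec add0r Yop_hprod.
have [L _] := low_term_prod_dser x delta k.
rewrite L; last by rewrite gtrDr.
by rewrite (lin0 (tens_linear _)) scaler0.
Qed.

Lemma Yop_hvec0 k : Yop D eps (hvec D 0 k) 0 (expv F la) =
  eps (rt D (unzip1 k)) la *: tens (la + rt D (unzip1 k)) (\prod_(q <- k) hshift x delta q).
Proof.
rewrite /hvec add0r Yop_hprod add0r.
by have [_ ->] := low_term_prod_dser x delta k; rewrite [la + _]addrC.
Qed.

End FusionMap.

(** * Exactness *)

Lemma lin_id_sub (F : fieldType) (M : lmodType F) (f : M -> M) :
  linear f -> linear (fun y => y - f y).
Proof. by move=> lf c y z; rewrite lf opprD scalerBr addrACA. Qed.

Section Exactness.
Variables (F : fieldType) (l : nat) (D : ade_algebra F l).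
Variable eps : weight l -> weight l -> F.
Hypothesis char0 : [pchar F] =i pred0.
Hypothesis eps_neq0 : forall b c, eps b c != 0.
Local Notation g := (lie D).
Local Notation P := (weight l).
Local Notation I := ('I_l * nat)%type.
Local Notation fock := {malg F[{cmonom I}]}.
Local Notation VP := (VP F l).
Local Notation x := (@fvar F l).
Implicit Types (b c : P) (cs : seq 'I_l) (f : fock) (v w : VP) (k : seq I).
Variables (X : affine_action D eps) (u : 'I_l -> lie D) (i : 'I_l).

Let delta (j : 'I_l) : bool := j == i.
Local Notation la := (lambda i).

Lemma lambda_delta j : la 0 j = Posz (delta j).
Proof. by rewrite mxE eqxx /delta; case: (j == i). Qed.

Definition up k : seq I := [seq (q.1, (q.2 + delta q.1)%N) | q <- k].
Definition down k : seq I := [seq (q.1, (q.2 - delta q.1)%N) | q <- k].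

Lemma hshift_up k : \prod_(q <- up k) hshift x delta q = hprod x k.
Proof.
rewrite /up big_map; apply: eq_bigr => -[j n] _; rewrite /hshift /=.
by rewrite leq_addl addnK.
Qed.

Lemma unzip1_up k : unzip1 (up k) = unzip1 k.
Proof. by rewrite /unzip1 -map_comp. Qed.

Lemma unzip1_down k : unzip1 (down k) = unzip1 k.
Proof. by rewrite /unzip1 -map_comp. Qed.

Lemma downK k : (i, 0%N) \notin k -> up (down k) = k.
Proof.
move=> ik; rewrite /up /down -map_comp -[RHS]map_id; apply/eq_in_map => -[j n] jk /=.
congr (_, _); rewrite subnK // /delta; case: eqP => // ji; case: n jk => // jk.
by move: ik; rewrite -ji jk.
Qed.

Lemma hshift_down k : (i, 0%N) \notin k ->
  \prod_(q <- k) hshift x delta q = hprod x (down k).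
Proof. by move=> ik; rewrite -{1}(downK ik) hshift_up. Qed.

Lemma hshift_eq0 k : (i, 0%N) \in k -> \prod_(q <- k) hshift x delta q = 0.
Proof.
move=> ik; rewrite (perm_big _ (perm_to_rem ik)) big_cons /hshift /= /delta eqxx.
by rewrite mul0r.
Qed.

(* A left inverse of h(i, k) |-> h(i, k - 1): solving Newton's identities expresses a
   polynomial in the h(j, k), k > 0, and the charge tells how many factors h(i, 0) = 1
   have been lost. *)
Definition yvar (q : I) : fock := if q.2 is m.+1 then x (q.1, m) else 1.

Lemma ynewton_ex j : exists N : nat -> fock, forall n,
  n.+1%:R *: yvar (j, n.+1) = \sum_(r < n.+1) N r * yvar (j, (n - r)%N).
Proof. exact: (@newton_solve _ _ (fun n => yvar (j, n))). Qed.

Definition ynewton (q : I) : fock := sval (cid (ynewton_ex q.1)) q.2.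

Lemma ynewtonP j n : n.+1%:R *: yvar (j, n.+1) =
  \sum_(r < n.+1) ynewton (j, r : nat) * yvar (j, (n - r)%N).
Proof. exact: (svalP (cid (ynewton_ex j))). Qed.

Fixpoint ymon k : {cmonom I} :=
  if k is q :: k' then
    if q.2 is m.+1 then mcons (q.1, m) (ymon k') else ymon k'
  else mone.

Lemma mext_hprod k : mext ynewton (hprod x k) = mon F (ymon k).
Proof.
have T := hprod_transfer char0 ynewtonP (mext_linear _) (mext_var _) k.
have e1 : \prod_(q <- k) yvar (q.1, 0%N) = 1 by rewrite big1.
rewrite e1 mext1 !mulr1 in T; rewrite T {T e1}.
elim: k => [|[j [|n]] k IH]; first by rewrite big_nil mon1.
  by rewrite big_cons IH [yvar _]/= mul1r.
by rewrite big_cons IH [yvar _]/= fvarU.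
Qed.

Definition ylift (n : nat) : fock -> fock := lext (fun m : {cmonom I} =>
  (\prod_(q <- fock_seq m) hsym x (q.1, (q.2.+1 + delta q.1)%N)) *
  hsym x (i, 1%N) ^+ (n - count_mem i (unzip1 (fock_seq m)))).

Lemma ylift_linear n : linear (ylift n).
Proof. exact: lext_linear. Qed.

Lemma ylift_hprod k :
  ylift (count_mem i (unzip1 k)) (mext ynewton (hprod x k)) = hprod x (up k).
Proof.
rewrite mext_hprod /ylift lext_mon.
suff [_ ->] : (count_mem i (unzip1 (fock_seq (ymon k))) <= count_mem i (unzip1 k))%N /\
  (\prod_(q <- fock_seq (ymon k)) hsym x (q.1, (q.2.+1 + delta q.1)%N)) *
    hsym x (i, 1%N) ^+ (count_mem i (unzip1 k) - count_mem i (unzip1 (fock_seq (ymon k))))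
  = hprod x (up k) by [].
elim: k => [|[j n] k [le IH]].
  by rewrite fock_seq1 /= !big_nil mulr1 /hprod big_nil.
rewrite [unzip1 (_ :: _)]/= [count_mem i (_ :: _)]/= [up _]/= /hprod big_cons -/(hprod x (up k)).
case: n => [|n].
  rewrite [ymon _]/= -IH; split; first exact: leq_trans le (leq_addl _ _).
  rewrite /delta; case: eqP => [->|_]; last by rewrite add0n (hsym0 char0) mul1r.
  by rewrite -(addnBA _ le) exprS mulrCA.
rewrite [ymon _]/=.
have pm := fock_seq_mul (j, n) (ymon k).
have cm : count_mem i (unzip1 (fock_seq (mcons (j, n) (ymon k)))) =
    ((j == i) + count_mem i (unzip1 (fock_seq (ymon k))))%N.
  by rewrite (permP (perm_map fst pm)).
rewrite cm leq_add2l subnDl (perm_big _ pm) big_cons; split; first exact: le.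
by rewrite -IH mulrA.
Qed.

Definition ycharge c : nat := xget 0%N [set n | form (wt D c) (fwt D i) = n%:R].

Lemma ycharge_rt cs : ycharge (rt D cs) = count_mem i cs.
Proof.
rewrite /ycharge; case: xgetP => [n _ /=|/(_ (count_mem i cs))]; last by rewrite /= form_rt_fwt.
rewrite form_rt_fwt => /esym E.
have /(intr_inj0 char0) [] : (Posz n)%:~R = (Posz (count_mem i cs))%:~R :> F by exact: E.
by [].
Qed.

Definition Yc_inv : VP -> VP := lin_ext (fun d =>
  (eps (d.2 - la) la)^-1 *:
    tens (d.2 - la) (ylift (ycharge (d.2 - la)) (mext ynewton (mon F d.1)))).

Lemma Yc_inv_linear : linear Yc_inv.
Proof. exact: lin_ext_linear. Qed.

Lemma Yc_inv_tens b f : Yc_inv (tens b f) = (eps (b - la) la)^-1 *: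
  tens (b - la) (ylift (ycharge (b - la)) (mext ynewton f)).
Proof.
move: f; apply: fock_linear_ext => [||m].
- exact: (lin_comp (tens_linear b) (lin_ext_linear _)).
- have L := lin_comp (lin_comp (mext_linear ynewton) (ylift_linear (ycharge (b - la))))
    (tens_linear (b - la)).
  by move=> a f f'; rewrite L scalerDr !scalerA mulrC.
by rewrite tens_mon /Yc_inv lin_ext_bas.
Qed.

Lemma omega_lambda : omega D i + la = alpha D i.
Proof. by rewrite /omega subrK. Qed.

Lemma e_omega_hvec k : e_op eps (omega D i) (hvec D la k) =
  eps (omega D i) (la + rt D (unzip1 k)) *: hvec D 0 ((i, 0%N) :: k).
Proof.
rewrite /hvec e_op_tens addrA omega_lambda add0r [unzip1 _]/= rt_cons /hprod big_cons.
by rewrite (hsym0 char0) mul1r.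
Qed.

Lemma Yc_hspace v : hspace D 0 v -> Yc eps u la v = Yop D eps v 0 (expv F la).
Proof.
move=> Hv; apply: Yc_trunc => n n0; move: v Hv.
apply: lspan_min => [|_ [k ->]].
  exact: (subspace_preim (Yop_linear D eps n (expv F la)) (@subspace0 _ _)).
exact: (Yop_hvec_low D eps char0 lambda_delta).
Qed.

Lemma Yop_hvec k : Yop D eps (hvec D 0 k) 0 (expv F la) =
  eps (rt D (unzip1 k)) la *:
    (if (i, 0%N) \in k then 0 else hvec D la (down k)).
Proof.
rewrite (Yop_hvec0 D eps char0 lambda_delta); congr (_ *: _).
case: ifP => [ik|/negbT ik]; first by rewrite (hshift_eq0 ik) (lin0 (tens_linear _)).
by rewrite (hshift_down ik) /hvec unzip1_down.
Qed.

Lemma hspace_sub_image v : hspace D 0 v ->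
  exists2 a, hspace D la a & e_op eps (omega D i) a = v - Yc_inv (Yop D eps v 0 (expv F la)).
Proof.
have SS : subspace [set v | exists2 a, hspace D la a & e_op eps (omega D i) a = v].
  split; first by exists 0;
    [exact: (subspace_0 (subspace_hspace D _))|exact: (lin0 (e_op_linear _ _))].
  move=> c _ _ [a Ha <-] [a' Ha' <-]; exists (c *: a + a'); last exact: e_op_linear.
  exact: (subspaceP (subspace_hspace D _)).
have L := lin_id_sub (lin_comp (Yop_linear D eps 0 (expv F la))
  Yc_inv_linear).
move: v; apply: lspan_min => [|_ [k ->]]; first exact: (subspace_preim L SS).
rewrite Yop_hvec.
case: ifP => [ik|/negbT ik].
  rewrite scaler0 (lin0 Yc_inv_linear) subr0.
  have pk := perm_to_rem ik; set k1 := rem _ k in pk.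
  have -> : hvec D 0 k = hvec D 0 ((i, 0%N) :: k1).
    rewrite /hvec /hprod (perm_big _ pk) /rt.
    by rewrite (perm_big _ (perm_map fst pk)).
  set e := eps (omega D i) (la + rt D (unzip1 k1)).
  exists (e^-1 *: hvec D la k1).
    by apply: (subspaceZ (subspace_hspace D _)); apply: lspan_gen; exists k1.
  by rewrite (linZ (e_op_linear _ _)) e_omega_hvec scalerA (mulVf (eps_neq0 _ _)) scale1r.
exists 0; first exact: (subspace_0 (subspace_hspace D _)).
rewrite (lin0 (e_op_linear _ _)) (linZ Yc_inv_linear) /hvec Yc_inv_tens.
rewrite unzip1_down addrAC subrr add0r scalerA (divff (eps_neq0 _ _)) scale1r ycharge_rt.
by rewrite -(unzip1_down k) ylift_hprod unzip1_down (downK ik) subrr.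
Qed.

Lemma e_op_inj b : injective (e_op eps b : VP -> VP).
Proof.
pose inv : VP -> VP := lin_ext (fun d => (eps b (d.2 - b))^-1 *: bas F (d.1, d.2 - b)).
have invL : linear inv by exact: lin_ext_linear.
have inv_bas d : inv (e_op eps b (bas F d)) = bas F d.
  case: d => m c; have bcb : b + c - b = c by rewrite addrAC subrr add0r.
  rewrite /e_op lin_ext_bas (linZ invL) /inv lin_ext_bas [(_, _).1]/= [(_, _).2]/= bcb.
  by rewrite scalerA (divff (eps_neq0 _ _)) scale1r.
have lid : linear (fun v : VP => v) by [].
have invK v : inv (e_op eps b v) = v.
  exact: (VP_subspace (subspace_eq (lin_comp (e_op_linear eps b) invL) lid) inv_bas).
by move=> v w E; rewrite -(invK v) E invK.
Qed.

Lemma principal_short_exact :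
  short_exact (W X la) (e_op eps (omega D i)) (W X 0) (Yc eps u la) (W X la).
Proof.
rewrite (W_hspace char0 eps_neq0 X la) (W_hspace char0 eps_neq0 X 0); split.
- exact: subspace_hspace.
- exact: subspace_hspace.
- exact: subspace_hspace.
- by move=> c v w _ _; exact: e_op_linear.
- move=> c v w Hv Hw; rewrite (Yc_hspace Hv) (Yc_hspace Hw) Yc_hspace.
    exact: Yop_linear.
  exact: (subspaceP (subspace_hspace D _)).
- move: (subspace_hspace D 0) => S0.
  apply: lspan_min => [|_ [k ->]]; first exact: (subspace_preim (e_op_linear _ _) S0).
  rewrite e_omega_hvec; apply: (subspaceZ S0); apply: lspan_gen.
  by exists ((i, 0%N) :: k).
- move=> v Hv; rewrite (Yc_hspace Hv); move: v Hv.
  apply: lspan_min => [|_ [k ->]].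
    exact: (subspace_preim (Yop_linear D eps 0 _) (subspace_hspace D la)).
  rewrite Yop_hvec; apply: (subspaceZ (subspace_hspace D _)).
  case: ifP => _; first exact: (subspace_0 (subspace_hspace D _)).
  by apply: lspan_gen; exists (down k).
- by move=> v w _ _; exact: e_op_inj.
- move=> v Hv; rewrite (Yc_hspace Hv); split.
    move=> Yv; have := hspace_sub_image Hv.
    by rewrite Yv (lin0 Yc_inv_linear) subr0.
  move=> [a Ha <-]; move: a Ha; apply: lspan_min => [|_ [k ->]].
    exact: (subspace_preim (lin_comp (e_op_linear _ _) (Yop_linear D eps 0 _)) (@subspace0 _ _)).
  rewrite /= e_omega_hvec (linZ (Yop_linear D eps 0 _)) Yop_hvec mem_head.
  by rewrite !scaler0.
- move=> w Hw; suff : exists2 v, hspace D 0 v & Yop D eps v 0 (expv F la) = w.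
    by move=> [v Hv <-]; exists v; [exact: Hv|rewrite (Yc_hspace Hv)].
  move: w Hw; apply: lspan_min => [|_ [k ->]].
    split; first by exists 0;
    [exact: (subspace_0 (subspace_hspace D _))|exact: (lin0 (Yop_linear D eps 0 _))].
    move=> c _ _ [v Hv <-] [w Hw <-]; exists (c *: v + w); last exact: (Yop_linear D eps 0 _).
    exact: (subspaceP (subspace_hspace D _)).
  exists ((eps (rt D (unzip1 k)) la)^-1 *: hvec D 0 (up k)).
    by apply: (subspaceZ (subspace_hspace D _)); apply: lspan_gen; exists (up k).
  rewrite (linZ (Yop_linear D eps 0 _)) (Yop_hvec0 D eps char0 lambda_delta) hshift_up unzip1_up.
  by rewrite scalerA (mulVf (eps_neq0 _ _)) scale1r.
Qed.

End Exactness.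

Theorem theorem5p1 (R : realType) (l : nat) (D : ade_algebra R[i] l)
  (s : nat) (eps : weight l -> weight l -> R[i])
  (heps : is_lattice_cocycle D s eps)
  (X : affine_action D eps)
  (u : 'I_l -> lie D) (hu : orthonormal_basis u) (i : 'I_l) :
  short_exact (W X (lambda i)) (e_op eps (omega D i))
              (W X 0%R) (Yc eps u (lambda i))
              (W X (lambda i)) /\
  (level D (Some i) 1 ->
   short_exact (W_Lambda X (Some i)) (e_op eps (omega D i))
               (W_Lambda X None) (Yc eps u (lambda i))
               (W_Lambda X (Some i))).
Proof.
have char0 : [pchar R[i]] =i pred0 by exact: pchar_num.
have eps_neq0 b c : eps b c != 0.
  apply/eqP => e0; have := eps_root1 heps b c.
  rewrite e0 expr0n eqn0Ngt (eps_s_gt0 heps) => /esym/eqP.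
  by rewrite oner_eq0.
by split=> [|_]; exact: (principal_short_exact char0 eps_neq0 X u i).
Qed.
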